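(* Let $F_1$ and $F_2$ be function fields over $\mathbb R$ of transcendence degree $\ge1$, both contained in a common extension field of $\mathbb R$ and linearly disjoint over $\mathbb R$, and let $F=F_1F_2$ be their compositum. Then the image of every compatible embedding $\iota:M(F_1)\times M(F_2)\to M(F)$ is dense in $M(F)$, and every non-empty basic open subset of $M(F)$ contains infinitely many places that are not in the image of $\iota$.
   Context: A function field over $\mathbb R$ is a finitely generated field extension of $\mathbb R$. For a field $K$, $M(K)$ is the set of $\mathbb R$-places $K\to\mathbb R\cup\{\infty\}$, with topology generated by the subbasis $H'(b)=\{\zeta\in M(K)\mid \infty\ne\zeta(b)>0\}$, $b\in K$; basic open sets are finite intersections of such sets. Let $\rho:M(F)\to M(F_1)\times M(F_2)$, $\xi\mapsto(\xi|_{F_1},\xi|_{F_2})$; a compatible embedding is an injective map $\iota:M(F_1)\times M(F_2)\to M(F)$ with $\rho\circ\iota=\mathrm{id}$. *)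

(* Defs.v *)
From HB Require Import structures.
From mathcomp Require Import all_boot all_order all_algebra.
From mathcomp Require Import boolp classical_sets cardinality reals.
Set Implicit Arguments. Unset Strict Implicit. Unset Printing Implicit Defensive.
Import Order.TTheory GRing.Theory Num.Theory.
Local Open Scope ring_scope.
Local Open Scope classical_set_scope.

Section Defs.
Variables (R : realType) (F : fieldType) (emb : {rmorphism R -> F}).

Definition is_Rsubfield (K : set F) : Prop :=
  (forall r, K (emb r)) /\
  (forall x y, K x -> K y -> K (x - y) /\ K (x * y)) /\
  (forall x, K x -> K x^-1).

Definition gen_field (S : set F) : set F :=
  [set x | forall K, is_Rsubfield K -> S `<=` K -> K x].

Definition function_field (K : set F) : Prop :=
  exists s : seq F, K = gen_field [set x | x \in s].

Definition trdeg_ge1 (K : set F) : Prop :=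
  exists x, K x /\ forall p : {poly R}, p != 0 -> (map_poly emb p).[x] != 0.

Definition lin_disjoint (K1 K2 : set F) : Prop :=
  forall (n : nat) (a b : 'I_n -> F),
    (forall i, K1 (a i)) -> (forall i, K2 (b i)) ->
    (forall c : 'I_n -> R, \sum_i emb (c i) * a i = 0 -> forall i, c i = 0) ->
    \sum_i a i * b i = 0 -> forall i, b i = 0.
End Defs.

(* R-places of the field whose elements are represented by D via j : D -> F
   (j = id for F itself, j = val for a subfield {x | K x});
   None stands for infinity. *)
Definition Rplace (R : realType) (F : fieldType) (D : Type) (j : D -> F)
    (z : D -> option R) : Prop :=
  (forall u, j u = 1 -> z u = Some 1) /\
  (forall u v w a b, z u = Some a -> z v = Some b -> j w = j u + j v ->
     z w = Some (a + b)) /\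
  (forall u v w a b, z u = Some a -> z v = Some b -> j w = j u * j v ->
     z w = Some (a * b)) /\
  (forall u v, j u * j v = 1 -> (z u = None <-> z v = Some 0)).

Definition Mplaces (R : realType) (F : fieldType) (D : Type) (j : D -> F) :
  set (D -> option R) := [set z | Rplace j z].

Definition Hsub (R : realType) (F : fieldType) (b : F) : set (F -> option R) :=
  [set z | Mplaces (@id F) z /\ exists r, z b = Some r /\ 0 < r].

(* basic open set: finite intersection of subbasic ones (the empty
   intersection being M(F)) *)
Definition basic_open (R : realType) (F : fieldType) (bs : seq F) :
  set (F -> option R) :=
  Mplaces (@id F) `&` [set z | forall b, b \in bs -> Hsub b z].

Definition M_open (R : realType) (F : fieldType) (U : set (F -> option R)) : Prop :=
  U `<=` Mplaces (@id F) /\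
  forall z, U z -> exists bs, basic_open (R:=R) bs z /\ basic_open (R:=R) bs `<=` U.

Definition M_dense (R : realType) (F : fieldType) (S : set (F -> option R)) : Prop :=
  forall U, M_open U -> U !=set0 -> (U `&` S) !=set0.

Definition compatible_embedding (R : realType) (F : fieldType) (F1 F2 : set F)
  (iota : ({x : F | F1 x} -> option R) * ({x : F | F2 x} -> option R) -> (F -> option R))
  : Prop :=
  let M1 := Mplaces (@proj1_sig F F1) in
  let M2 := Mplaces (@proj1_sig F F2) in
  (forall p, (M1 `*` M2) p -> Mplaces (@id F) (iota p)) /\
  {in M1 `*` M2 &, injective iota} /\
  (forall p, (M1 `*` M2) p ->
     (fun u : {x : F | F1 x} => iota p (proj1_sig u)) = p.1 /\
     (fun u : {x : F | F2 x} => iota p (proj1_sig u)) = p.2).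

(* Main.v *)
Require Import Defs.
From HB Require Import structures.
From mathcomp Require Import all_boot all_order all_algebra closed_field.
From mathcomp Require Import boolp classical_sets cardinality reals.
From mathcomp Require Import polyrcf qe_rcf_th ring lra zify.
Set Implicit Arguments. Unset Strict Implicit. Unset Printing Implicit Defensive.
Import Order.TTheory GRing.Theory Num.Theory.
Local Open Scope ring_scope.
Local Open Scope classical_set_scope.

(* A non-empty basic open set U contains a place, hence (Baer-Krull) F has an
   ordering P in which the elements defining U are positive. A variant of Artin-Lang
   perturbs P: F = R(a_1, .., a_n), and along the tower Q(rs)(a_1, .., a_j), rs a finite
   list of reals, one constructs field homomorphisms to R with prescribed signs, each
   of them a limit of homomorphisms defined on arbitrarily large such subfields. The
   signs are transferred from the real closure of a countable subfield to R by Tarski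
   queries; transcendental steps use that R is uncountable and algebraic ones that
   simple roots vary continuously. The elements of F that are nonnegative under all
   homomorphisms close to the limit form a preordering, and the real place of an
   ordering containing it takes finite values on any finite set fixed in advance.
   Choosing this finite set large enough, all places of F with the same restrictions
   to F1 and F2 lie in U, which gives density.

   Over any pair of restrictions there are two different places of F: extend the place
   of F2 to F trivially on F1 and compose with the place of F1, or the other way round;
   linear disjointness makes this well defined. They differ at y / x for x in F1 and
   y in F2 of value 0, so one of them is not in the image of the embedding. The value
   at an element of F1 transcendental over R can be kept away from finitely many
   reals, so there are infinitely many of them. *)

(** * Transfer of sign conditions between real closed fields *)

(** Elements of F are fractions of sums of products from F1 and F2. A place in the given open set
    may be infinite on the terms of the fractions defining that set, and then its restrictions do
    not determine their values. Hence the detour through an ordering: it keeps only signs and leaves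
    room for another place, finite on all these ingredients. Finiteness at [b] and at [b^-1] forces
    a nonzero value, so weak signs suffice. No homomorphism F -> R fixes the reals: if x,
    transcendental over R, had image r, then x - r would be sent to 0. So homomorphisms are taken on
    finitely generated extensions of the rationals. Being countable, these have a real closure
    inside a countable algebraic closure, and leave room for transcendental images in R. A single
    such homomorphism orders only a subfield; because it is approximated on every larger one, the
    conditions shared by all close homomorphisms do not contain -1 and form a preordering of the
    whole of F. *)

Section SignTransfer.
Variable k : fieldType.
Implicit Types (p q : {poly k}) (sq : seq {poly k}).

(** Pseudo-division commutes with field embeddings, so one sequence over [k] yields the signed
    remainder sequences over all [L] at once. *)
Lemma mods_map p q : exists s : seq {poly k},
  forall (L : rcfType) (i : {rmorphism k -> L}),
    mods (map_poly i p) (map_poly i q) = map (map_poly i) s.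
Proof.
have [n] := ubnP (size q); elim: n p q => // n IHn p q /ltnSE le_q.
have [->|p0] := eqVneq p 0.
  by exists [::] => L i; rewrite rmorph0 mods0p.
have [->|q0] := eqVneq q 0.
  by exists [:: p] => L i; rewrite rmorph0 modsp0 map_poly_eq0 (negPf p0).
pose r := - (lead_coef q ^+ Pdiv.Ring.rscalp p q) *: Pdiv.Ring.rmodp p q.
have [|s Hs] := IHn q r.
  rewrite (leq_trans _ le_q) // (leq_ltn_trans (size_scale_leq _ _)) //.
  by rewrite Pdiv.Ring.ltn_rmodp.
exists (p :: s) => L i; rewrite neq0_mods_rec ?map_poly_eq0 //=; congr (_ :: _).
rewrite -Hs; congr mods; rewrite /next_mod /r map_polyZ rmorphN rmorphXn /=.
by rewrite lead_coef_map /Pdiv.Ring.rscalp /Pdiv.Ring.rmodp redivp_map.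
Qed.

Lemma eq_changes (L1 L2 : rcfType) (s1 : seq L1) (s2 : seq L2) :
  [seq sgz x | x <- s1] = [seq sgz x | x <- s2] -> changes s1 = changes s2.
Proof.
elim: s1 s2 => [|a s1 IHs] [|b s2] //= [eq_ab eq_s].
congr (_ + _)%N; last exact: IHs.
congr (nat_of_bool _); rewrite -!sgz_cp0 !sgzM eq_ab.
by case: s1 s2 eq_s {IHs} => [|a' s1] [|b' s2] //=; rewrite ?sgz0 // => -[->].
Qed.

(** A Tarski query is a difference of numbers of sign changes of the remainder sequence at the two
    infinities; these depend only on degrees and on signs of leading coefficients. *)
Lemma taqR_transfer p q : exists W : seq k,
  forall (L1 L2 : rcfType) (i1 : {rmorphism k -> L1}) (i2 : {rmorphism k -> L2}),
    (forall w, w \in W -> sgz (i1 w) = sgz (i2 w)) ->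
    taqR (map_poly i1 p) (map_poly i1 q) = taqR (map_poly i2 p) (map_poly i2 q).
Proof.
have [s Hs] := mods_map p (p^`() * q).
exists (map lead_coef s) => L1 L2 i1 i2 Hi.
rewrite /taqR /changes_mods !deriv_map -!rmorphM !Hs /changes_poly.
have E r : r \in s -> sgz (lead_coef (map_poly i1 r)) = sgz (lead_coef (map_poly i2 r)).
  by move=> rs; rewrite !lead_coef_map Hi // map_f.
congr (_%:Z - _%:Z); rewrite /changes_minfty /changes_pinfty; apply: eq_changes.
  rewrite -!map_comp; apply/eq_in_map => r /E /=.
  rewrite !size_map_poly => Er; rewrite !sgzM Er.
  by case: (odd (size r)); rewrite /= ?expr0 ?expr1 ?sgzN !sgz1.
by rewrite -!map_comp; apply/eq_in_map => r /E /=.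
Qed.

(** The coefficients are entries of the inverse of an integer matrix. Being rational, they make
    counts in different fields comparable. *)
Lemma coefs_rat (L : numFieldType) n i : coefs L n i = ratr (coefs rat n i).
Proof.
have [lt_i|ge_i] := ltnP i (3 ^ n)%N; last first.
  by rewrite /coefs !nth_default ?rmorph0 // size_map size_enum_ord.
have o : 'I_(3 ^ n) by rewrite exp3n; apply: ord0.
have E (K : numFieldType) : coefs K n i =
    invmx (map_mx (intmul 1) (ctmat n)) (nth o (enum 'I_(3 ^ n)) i)
          (cast_ord (esym (exp3n n)) ord0).
  by rewrite /coefs (nth_map o) ?size_enum_ord // castmxE cast_ord_id.
rewrite !E.
have -> : map_mx ((intmul 1) : int -> L) (ctmat n) =
          map_mx (ratr : rat -> L) (map_mx (intmul 1) (ctmat n)).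
  by apply/matrixP=> a b; rewrite !mxE ratr_int.
by rewrite -map_invmx mxE.
Qed.

(** The count combines Tarski queries, integers that agree in both fields, with rational
    coefficients; both counts are images of the same rational number. *)
Lemma ccount_weak_transfer p sq : exists W : seq k,
  forall (L1 L2 : rcfType) (i1 : {rmorphism k -> L1}) (i2 : {rmorphism k -> L2}),
    (forall w, w \in W -> sgz (i1 w) = sgz (i2 w)) ->
    (0 < ccount_weak (map_poly i1 p) (map (map_poly i1) sq)) =
    (0 < ccount_weak (map_poly i2 p) (map (map_poly i2) sq)).
Proof.
pose pc (sc : seq int) := \prod_(i < size sq) sq`_i ^+ comb_exp sc`_i.
have pcE (L : rcfType) (i : {rmorphism k -> L}) sc :
    poly_comb (map (map_poly i) sq) sc = map_poly i (pc sc).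
  rewrite /poly_comb rmorph_prod size_map; apply: eq_bigr => j _.
  by rewrite (nth_map 0) // rmorphXn.
have [W HW] : exists W : seq k,
  forall (L1 L2 : rcfType) (i1 : {rmorphism k -> L1}) (i2 : {rmorphism k -> L2}),
    (forall w, w \in W -> sgz (i1 w) = sgz (i2 w)) ->
    forall sc, sc \in sg_tab (size sq) ->
    taqR (map_poly i1 p) (map_poly i1 (pc sc)) =
    taqR (map_poly i2 p) (map_poly i2 (pc sc)).
  elim: (sg_tab _) => [|sc s [W IHs]]; first by exists [::].
  have [W' HW'] := taqR_transfer p (pc sc).
  exists (W ++ W') => L1 L2 i1 i2 Hi u; rewrite inE => /orP[/eqP->|us].
    by apply: HW' => w wW'; apply: Hi; rewrite mem_cat wW' orbT.
  by apply: IHs => // w wW; apply: Hi; rewrite mem_cat wW.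
exists W => L1 L2 i1 i2 /HW{}HW.
have tE (j : nat) : (j < 3 ^ size sq)%N -> exists z : int,
    taqsR (map_poly i1 p) (map (map_poly i1) sq) j = z%:~R /\
    taqsR (map_poly i2 p) (map (map_poly i2) sq) j = z%:~R.
  move=> lt_j; have := HW (nth [::] (sg_tab (size sq)) j).
  rewrite mem_nth ?size_sg_tab // => /(_ isT) E.
  exists (taqR (map_poly i1 p) (map_poly i1 (pc (nth [::] (sg_tab (size sq)) j)))).
  rewrite /taqsR !size_map !(nth_map [::]) ?size_sg_tab // !pcE.
  by rewrite -E.
have [r [E1 E2]] : exists r : rat,
    ccount_weak (map_poly i1 p) (map (map_poly i1) sq) = ratr r /\
    ccount_weak (map_poly i2 p) (map (map_poly i2) sq) = ratr r.
  (* This exposes the recursion inside [ccount_weak], so that it can be followed in both fields with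
     a common rational accumulator. *)
  pose aux (L : rcfType) m (t : nat -> L) := fix aux (s : L) (j : nat) :=
    if j is j'.+1 then aux (t j' * coefs L m j' + s) j' else s.
  have cE (L : rcfType) (q : {poly L}) sr :
    ccount_weak q sr = aux L (size sr) (taqsR q sr) 0 (3 ^ size sr)%N by [].
  rewrite !cE !size_map; set t1 := taqsR _ _; set t2 := taqsR _ _.
  have gen n : forall s1 s2 s, (n <= 3 ^ size sq)%N -> s1 = ratr s -> s2 = ratr s ->
      exists r : rat, aux L1 (size sq) t1 s1 n = ratr r /\
                      aux L2 (size sq) t2 s2 n = ratr r.
    elim: n => [|n IHn] s1 s2 s le_n E1 E2; first by exists s.
    have [z [z1 z2]] := tE n le_n.
    rewrite /= /t1 /t2 z1 z2.
    apply: (IHn _ _ (z%:~R * coefs rat (size sq) n + s) (ltnW le_n)).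
      by rewrite E1 (coefs_rat L1) rmorphD rmorphM /= ratr_int.
    by rewrite E2 (coefs_rat L2) rmorphD rmorphM /= ratr_int.
  by apply: (gen _ _ _ 0) => //; rewrite rmorph0.
by rewrite E1 E2 !ltr0q.
Qed.


(** For [p = 0] the procedure looks at the critical points of the product of [sq] and at the signs
    at the two infinities; [W] serves all branches. *)
Lemma ccount_gt0_transfer p sq : exists W : seq k,
  forall (L1 L2 : rcfType) (i1 : {rmorphism k -> L1}) (i2 : {rmorphism k -> L2}),
    (forall w, w \in W -> sgz (i1 w) = sgz (i2 w)) ->
    ccount_gt0 [:: map_poly i1 p] (map (map_poly i1) sq) =
    ccount_gt0 [:: map_poly i2 p] (map (map_poly i2) sq).
Proof.
have [W1 H1] := ccount_weak_transfer p sq.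
have [W2 H2] := ccount_weak_transfer (\prod_(q <- sq) q)^`() sq.
exists (W1 ++ W2 ++ map lead_coef sq) => L1 L2 i1 i2 Hi.
rewrite /ccount_gt0 !big_cons !big_nil !Pdiv.Ring.rgcdp0 !map_poly_eq0.
have -> := H1 L1 L2 i1 i2; last by move=> w wW; apply: Hi; rewrite mem_cat wW.
have bE (L : rcfType) (i : {rmorphism k -> L}) :
    bounding_poly (map (map_poly i) sq) = map_poly i (\prod_(q <- sq) q)^`().
  by rewrite /bounding_poly -deriv_map rmorph_prod big_map.
rewrite !bE.
have -> := H2 L1 L2 i1 i2; last by move=> w wW; apply: Hi; rewrite !mem_cat wW !orbT.
have lE q : q \in sq -> sgz (lead_coef (map_poly i1 q)) = sgz (lead_coef (map_poly i2 q)).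
  by move=> qs; rewrite !lead_coef_map Hi // !mem_cat map_f ?orbT.
congr (if _ then _ else [|| _, _ | _]); rewrite !big_map !big_seq; apply: eq_bigr => q /lE Eq.
  by rewrite -!sgz_cp0 Eq.
by rewrite !size_map_poly -!sgz_cp0 !sgzM Eq !sgzX !sgzN !sgz1.
Qed.

(** The signs of [fs] at [y] amount to one equation, a gcd vanishing, and finitely many strict
    inequalities; solvability of such a system is decided by signs in [k]. *)
Lemma sign_transfer (fs : seq {poly k}) (L1 : rcfType) (i1 : {rmorphism k -> L1}) (y : L1) :
  exists W : seq k, forall (L2 : rcfType) (i2 : {rmorphism k -> L2}),
    (forall w, w \in W -> sgz (i1 w) = sgz (i2 w)) ->
    exists y' : L2, forall f, f \in fs ->
      sgz (map_poly i1 f).[y] = sgz (map_poly i2 f).[y'].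
Proof.
pose s (f : {poly k}) := sgz (map_poly i1 f).[y].
pose sp := [seq f <- fs | s f == 0].
pose sq := [seq f <- fs | s f == 1] ++ [seq - f | f <- fs & s f == -1].
(* If no polynomial vanishes at [y], this gcd is 0 and the equation is void. *)
pose p := \big[@gcdp _/0]_(f <- sp) f.
have rootE (L : rcfType) (i : {rmorphism k -> L}) x :
    root (map_poly i p) x = all (fun f => root (map_poly i f) x) sp.
  rewrite /p {p}; elim: sp => [|f r IHr]; first by rewrite big_nil rmorph0 root0.
  by rewrite big_cons gcdp_map root_gcd IHr.
have [W HW] := ccount_gt0_transfer p sq.
exists W => L2 i2 /HW E.
have : ccount_gt0 [:: map_poly i1 p] (map (map_poly i1) sq).
  apply/ccount_gt0P; exists y; rewrite big_cons big_nil andbT big_map big_all; apply/andP; split.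
    by rewrite -/(root _ y) rootE; apply/allP => f; rewrite mem_filter /s sgz_eq0 => /andP[].
  apply/allP => f; rewrite mem_cat => /orP[]; first by rewrite mem_filter /s -sgz_cp0 => /andP[].
  move=> /mapP[g]; rewrite mem_filter => /andP[sg _] ->.
  by rewrite rmorphN hornerN oppr_gt0 -sgz_cp0.
rewrite E => /ccount_gt0P[y']; rewrite big_cons big_nil andbT big_map big_all -/(root _ _) rootE.
move=> /andP[/allP Hp /allP Hq].
exists y' => f ffs; rewrite -/(s f).
have : s f \in [:: 0; 1; -1] by rewrite /s; case: sgzP.
rewrite !inE => /or3P[] /eqP sf; rewrite sf; symmetry; apply/eqP.
- by rewrite sgz_eq0; apply: Hp; rewrite mem_filter sf eqxx.
- by rewrite sgz_cp0 Hq // mem_cat mem_filter sf eqxx ffs.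
have := Hq (- f); rewrite mem_cat map_f ?mem_filter ?sf ?eqxx ?ffs // orbT => /(_ isT).
by rewrite rmorphN hornerN oppr_gt0 sgz_cp0.
Qed.

End SignTransfer.

(** * Subfields and orderings *)

Definition sfield (F : fieldType) (S : divringClosed F) := {x : F | x \in S}.
Section SField.
Variables (F : fieldType) (S : divringClosed F).
HB.instance Definition _ := [isSub of sfield S for @sval F (fun x => x \in S)].
HB.instance Definition _ := [Choice of sfield S by <:].
HB.instance Definition _ := [SubChoice_isSubIntegralDomain of sfield S by <:].
HB.instance Definition _ := [SubIntegralDomain_isSubField of sfield S by <:].
End SField.

Definition is_subfield (F : fieldType) (K : set F) :=
  [/\ K 1, forall x y, K x -> K y -> K (x - y) & forall x y, K x -> K y -> K (x / y)].

Lemma subfield_type (F : fieldType) (K : set F) : is_subfield K ->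
  exists (k : fieldType) (j : {rmorphism k -> F}), forall x, K x <-> exists u, j u = x.
Proof.
move=> [K1 KB KV]; pose S : {pred F} := fun x => `[< K x >].
have HS : divring_closed S.
  split=> [|x y|x y]; first exact/asboolP.
    by move=> /asboolP Kx /asboolP Ky; apply/asboolP/KB.
  by move=> /asboolP Kx /asboolP Ky; apply/asboolP/KV.
pose Sd : divringClosed F := HB.pack S (GRing.isDivringClosed.Build F S HS).
exists (sfield Sd), (val : {rmorphism sfield Sd -> F}) => x; split.
  by move=> /asboolP Kx; exists (exist _ x Kx).
by case=> u <-; apply/asboolP/(valP u).
Qed.

Section Subfield.
Variables (F : fieldType) (K : set F).
Hypothesis HK : is_subfield K.
Lemma subfield1 : K 1. Proof. by case: HK. Qed.
Lemma subfieldB x y : K x -> K y -> K (x - y). Proof. by case: HK => _ + _; apply. Qed.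
Lemma subfield0 : K 0. Proof. by rewrite -(subrr 1); apply: subfieldB subfield1 subfield1. Qed.
Lemma subfieldN x : K x -> K (- x).
Proof. by move=> Kx; rewrite -sub0r; apply: subfieldB => //; apply: subfield0. Qed.
Lemma subfieldD x y : K x -> K y -> K (x + y).
Proof. by move=> Kx Ky; rewrite -[y]opprK; apply/subfieldB/subfieldN. Qed.
Lemma subfieldV x : K x -> K x^-1.
Proof. by move=> Kx; rewrite -div1r; case: HK => K1 _; apply. Qed.
Lemma subfieldM x y : K x -> K y -> K (x * y).
Proof. by move=> Kx Ky; rewrite -[y]invrK; case: HK => _ _; apply=> //; apply: subfieldV. Qed.
End Subfield.

(** * Preorderings and their extension to orderings *)

Definition precone (F : fieldType) (T : set F) :=
  [/\ forall x, T (x ^+ 2), forall x y, T x -> T y -> T (x + y),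
      forall x y, T x -> T y -> T (x * y) & ~ T (-1)].

Definition cone (F : fieldType) (T : set F) :=
  precone T /\ forall x, T x \/ T (- x).

(** [Zorn_bigcup] also covers the empty chain, whose union is empty, so the empty set is added to
    the family; the nonempty [A0] keeps the maximal member in [P]. *)
Lemma Zorn_above (T : Type) (P : set (set T)) (A0 : set T) :
  P A0 -> A0 !=set0 ->
  (forall G : set (set T), G !=set0 -> G `<=` P -> total_on G subset ->
     P (\bigcup_(X in G) X)) ->
  exists A, P A /\ forall B, P B -> A `<=` B -> B `<=` A.
Proof.
move=> PA0 A00 chain.
have [G GP totG|A [PA maxA]] := @Zorn_bigcup T [set A | A = set0 \/ P A].
  have [[X [GX X0]]|noX] := pselect (exists X, G X /\ X <> set0).
    right; have -> : \bigcup_(X in G) X = \bigcup_(X in G `&` [set X | X <> set0]) X.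
      apply/seteqP; split => x [Y]; last by case=> GY _ Yx; exists Y.
      by move=> GY Yx; exists Y => //; split=> // Y0; rewrite Y0 in Yx.
    apply: chain; first by exists X.
      by move=> Y [/GP[]].
    by move=> Y Z [GY _] [GZ _]; apply: totG.
  left; rewrite -subset0 => x [Y GY Yx]; apply: noX; exists Y; split=> // Y0.
  by rewrite Y0 in Yx.
have strict B : P B -> A `<=` B -> B `<=` A.
  move=> PB AB; apply: contrapT => BA; apply: (maxA B); last by right.
  by split=> // AB'.
exists A; split=> //; case: PA => // A_0; case: A00 => x A0x.
have : A x by apply: (strict A0) => //; rewrite A_0.
by rewrite A_0.
Qed.

Section Precone.
Variables (F : fieldType) (T : set F).
Hypothesis HT : precone T.
Lemma precone_sqr x : T (x ^+ 2). Proof. by case: HT. Qed.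
Lemma preconeD x y : T x -> T y -> T (x + y). Proof. by case: HT => _ + _ _; apply. Qed.
Lemma preconeM x y : T x -> T y -> T (x * y). Proof. by case: HT => _ _ + _; apply. Qed.
Lemma preconeN1 : ~ T (-1). Proof. by case: HT. Qed.
Lemma precone0 : T 0. Proof. by have := precone_sqr 0; rewrite expr0n. Qed.
Lemma precone1 : T 1. Proof. by have := precone_sqr 1; rewrite expr1n. Qed.
Lemma preconeV x : T x -> T x^-1.
Proof.
have [->|x0 Tx] := eqVneq x 0; first by rewrite invr0.
have -> : x^-1 = x * (x^-1) ^+ 2 by field.
by apply: preconeM => //; apply: precone_sqr.
Qed.
Lemma precone_anti x : T x -> T (- x) -> x = 0.
Proof.
move=> Tx TNx; apply/eqP/negP => /negP x0; apply: preconeN1.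
have -> : -1 = (- x) * x^-1 by field.
by apply: preconeM => //; apply: preconeV.
Qed.
End Precone.

(** A maximal preordering [P] is an ordering: for [x] outside [P], the set [P - x P] is again a
    preordering, since [-1 = p - x q] would put [x = (1 + p) / q] in [P]. *)
Lemma cone_extend (F : fieldType) (T : set F) : precone T ->
  exists P, cone P /\ T `<=` P.
Proof.
move=> HT; pose C := [set A | precone A /\ T `<=` A].
have [||G [X0 GX0] GC totG|P [[HP TP] maxP]] := @Zorn_above F C T.
- by split.
- by exists 0; apply: precone0.
- split; last by move=> x Tx; exists X0 => //; case: (GC _ GX0) => _; apply.
  have pair x y : (\bigcup_(X in G) X) x -> (\bigcup_(X in G) X) y ->
      exists X, [/\ G X, precone X, X x & X y].
    move=> [X GX Xx] [Y GY Yy]; have [XY|YX] := totG _ _ GX GY.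
      by exists Y; split=> //; [case: (GC _ GY)|apply: XY].
    by exists X; split=> //; [case: (GC _ GX)|apply: YX].
  split.
  + by move=> x; exists X0 => //; case: (GC _ GX0) => HX _; apply: precone_sqr.
  + by move=> x y /pair/[apply] -[X [GX HX Xx Xy]]; exists X => //; apply: preconeD.
  + by move=> x y /pair/[apply] -[X [GX HX Xx Xy]]; exists X => //; apply: preconeM.
  + by case=> X GX; case: (GC _ GX) => HX _; apply: preconeN1.
exists P; split=> //; split=> // x.
have [Px|nPx] := pselect (P x); [by left|right].
pose Q := [set z | exists p q, [/\ P p, P q & z = p - x * q]].
have PQ : P `<=` Q by move=> p Pp; exists p, 0; split=> //; [apply: precone0|ring].
have Qx : Q (- x) by exists 0, 1; split; [apply: precone0|apply: precone1|ring].
suff HQ : precone Q by apply: (maxP Q) => //; split=> // z /TP /PQ.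
split.
- by move=> z; apply: PQ; apply: precone_sqr.
- move=> _ _ [p [q [Pp Pq ->]]] [p' [q' [Pp' Pq' ->]]].
  by exists (p + p'), (q + q'); split; [exact: preconeD|exact: preconeD|ring].
- move=> _ _ [p [q [Pp Pq ->]]] [p' [q' [Pp' Pq' ->]]].
  exists (p * p' + x ^+ 2 * (q * q')), (p * q' + q * p'); split; last by ring.
    apply: (preconeD HP); first exact: (preconeM HP).
    apply: (preconeM HP); [exact: (precone_sqr HP)|exact: (preconeM HP)].
  by apply: (preconeD HP); exact: (preconeM HP).
case=> p [q [Pp Pq E]]; apply: nPx.
have xq : x * q = 1 + p by rewrite -[x * q](subKr p) -E; ring.
have P1p : P (1 + p) by apply: preconeD => //; apply: precone1.
have q0 : q != 0.
  apply: contra_notN (preconeN1 HP) => /eqP q0; suff -> : -1 = p by [].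
  by rewrite E q0; ring.
have -> : x = (1 + p) * q^-1 by rewrite -xq mulfK.
by apply: preconeM => //; apply: preconeV.
Qed.

(** Sums of squares with weights in [P]: for multiplicatively closed [P] containing 1, a preordering
    as soon as -1 is not among them. *)
Inductive wsos (A : comNzRingType) (P : set A) : A -> Prop :=
| wsos0 : wsos P 0
| wsosS q f x : P q -> wsos P x -> wsos P (q * f ^+ 2 + x).

Section Wsos.
Variables (A : comNzRingType) (P : set A).
Lemma wsosD x y : wsos P x -> wsos P y -> wsos P (x + y).
Proof.
elim=> [|q f z Pq _ IH] Hy; first by rewrite add0r.
by rewrite -addrA; apply: wsosS => //; apply: IH.
Qed.
Lemma wsosM x y : (forall u v, P u -> P v -> P (u * v)) ->
  wsos P x -> wsos P y -> wsos P (x * y).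
Proof.
move=> PM; elim=> [|q f z Pq _ IH] Hy; first by rewrite mul0r; apply: wsos0.
rewrite mulrDl; apply: wsosD; last exact: IH.
elim: Hy => [|q' f' z' Pq' _ IH']; first by rewrite mulr0; apply: wsos0.
rewrite mulrDr; apply: wsosD => //.
have -> : q * f ^+ 2 * (q' * f' ^+ 2) = q * q' * (f * f') ^+ 2 + 0 by ring.
by apply: wsosS; [exact: PM|exact: wsos0].
Qed.
Lemma wsos_in q : P q -> wsos P q.
Proof.
move=> Pq; have -> : q = q * 1 ^+ 2 + 0 by ring.
by apply: wsosS => //; apply: wsos0.
Qed.
Lemma wsos_sqr x : P 1 -> wsos P (x ^+ 2).
Proof.
move=> P1; have -> : x ^+ 2 = 1 * x ^+ 2 + 0 by ring.
by apply: wsosS => //; apply: wsos0.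
Qed.
End Wsos.

Lemma wsos_precone (F : fieldType) (P : set F) :
  P 1 -> (forall u v, P u -> P v -> P (u * v)) -> ~ wsos P (-1) -> precone (wsos P).
Proof.
move=> P1 PM N1; split=> // [x|x y|x y]; [exact: wsos_sqr|exact: wsosD|exact: wsosM].
Qed.

Section SignChange.
Variable D : realFieldType.
Implicit Types (p q h : {poly D}) (a b : D).

Lemma sign_change_factor h a b : h.[a] * h.[b] < 0 ->
  exists p, [/\ irreducible_poly p, p %| h & p.[a] * p.[b] < 0].
Proof.
have [n] := ubnP (size h); elim: n h => // n IHn h /ltnSE le_h hab.
have [irr|nirr] := pselect (irreducible_poly h); first by exists h; split.
have h0 : h != 0 by apply: contraTneq hab => ->; rewrite !horner0 mul0r ltxx.
have h1 : (1 < size h)%N.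
  rewrite ltnNge; apply: contraTN hab => /size1_polyC->.
  by rewrite !hornerC -leNgt -expr2 sqr_ge0.
have [q [q1 qh nqh]] : exists q, [/\ size q != 1%N, q %| h & ~~ (q %= h)].
  apply: contrapT => H; apply: nirr; split=> // q q1 qh; apply: contrapT => nq.
  by apply: H; exists q; split=> //; apply/negP.
have [r hE] : exists r : {poly D}, h = r * q by have [r ->] := dvdpP _ _ qh; exists r.
have q0 : q != 0 by apply: contra_neq h0 => q0; rewrite hE q0 mulr0.
have r0 : r != 0 by apply: contra_neq h0 => r0; rewrite hE r0 mul0r.
have sh : size h = (size r + size q).-1 by rewrite hE size_mul.
have sq : (1 < size q)%N by rewrite ltn_neqAle eq_sym q1 lt0n size_poly_eq0.
have sr : (1 < size r)%N.
  rewrite ltn_neqAle lt0n size_poly_eq0 r0 andbT eq_sym; apply: contra nqh => /size_poly1P[c c0 rE].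
  by rewrite hE rE mul_polyC eqp_sym eqp_scale.
have prod_lt0 : (q.[a] * q.[b]) * (r.[a] * r.[b]) < 0.
  by move: hab; rewrite hE !hornerM; congr (_ < 0); ring.
have [qab|qab] := ltP (q.[a] * q.[b]) 0.
  have [|p [? pq ?]] := IHn q _ qab; last by exists p; split=> //; apply: dvdp_trans qh.
  by move: le_h; rewrite sh; lia.
have rab : r.[a] * r.[b] < 0 by rewrite ltNge; apply: contraTN prod_lt0 => ?; rewrite -leNgt mulr_ge0.
have [|p [? pr ?]] := IHn r _ rab; last by exists p; split=> //; rewrite hE dvdp_mulr.
by move: le_h; rewrite sh; lia.
Qed.

Definition nneg_const : set {poly D} := [set f | exists2 c, 0 <= c & f = c%:P].

Lemma wsos_horner_ge0 g a : wsos nneg_const g -> 0 <= g.[a].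
Proof.
elim=> [|_ f x [c c0 ->] _ IH]; first by rewrite horner0.
by rewrite hornerD hornerM hornerC horner_exp addr_ge0 // mulr_ge0 // sqr_ge0.
Qed.
End SignChange.

(** * Real closure of a countable ordered field *)

Section SignChangeExtension.
Variable D : realFieldType.
Implicit Types (p q h : {poly D}) (a b : D).

(** Each square is reduced modulo [p]. The bound means that the degree of [g'] is at most 2 deg p -
    2, so that a cofactor of [p] in [1 + g'] has smaller degree than [p]. *)
Lemma wsos_mod p g : (1 < size p)%N -> wsos (@nneg_const D) g ->
  exists g', [/\ wsos (@nneg_const D) g', p %| g - g' & (size g' + 3 <= (size p).*2)%N].
Proof.
move=> p1; elim=> [|_ f x [c c0 ->] _ [x' [Hx px sx]]].
  by exists 0; split; [exact: wsos0|rewrite subrr dvdp0|rewrite size_poly0; lia].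
exists (c%:P * (f %% p) ^+ 2 + x'); split.
- by apply: wsosS => //; exists c.
- rewrite opprD addrACA dvdp_add // -mulrBr subr_sqr.
  have -> : f - f %% p = f %/ p * p by rewrite {1}(divp_eq f p) addrK.
  by rewrite dvdp_mull // -mulrA mulrCA dvdp_mulr.
have sf : (size (f %% p)%R < size p)%N by rewrite ltn_modp -size_poly_gt0 ltnW.
have s2 : (size (c%:P * (f %% p)%R ^+ 2)%R <= (size (f %% p)%R).*2.-1)%N.
  rewrite mul_polyC (leq_trans (size_scale_leq _ _)) // expr2.
  by rewrite (leq_trans (size_polyMleq _ _)) // addnn.
have := size_polyD (c%:P * (f %% p) ^+ 2) x'.
move: s2 sf sx p1; set u := size _; set v := size _; set w := size _; set t := size _.
by set r := size _; lia.
Qed.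

(* The cofactor [h] of [p] in [1 + g] has smaller degree than [p] (once [g] is reduced
   modulo [p]) and changes sign with [p], since [1 + g] is positive. *)
Lemma sign_change_wsos p a b g : irreducible_poly p -> p.[a] * p.[b] < 0 ->
  wsos (@nneg_const D) g -> ~ p %| 1 + g.
Proof.
have [n] := ubnP (size p); elim: n p g => // n IHn p g /ltnSE le_p irr pab Hg pg.
have p1 : (1 < size p)%N by case: irr.
have [g' [Hg' pgg' sg']] := wsos_mod p1 Hg.
have : p %| 1 + g'.
  have -> : 1 + g' = (1 + g) - (g - g') by ring.
  by rewrite dvdp_sub.
move=> /dvdpP[h0 hE0]; pose h : {poly D} := h0; have hE : 1 + g' = h * p := hE0.
have pos c : 0 < h.[c] * p.[c].
  by rewrite -hornerM -hE hornerD hornerC ltr_pwDl // (wsos_horner_ge0 _ Hg').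
have hab : h.[a] * h.[b] < 0.
  have : 0 < (h.[a] * h.[b]) * (p.[a] * p.[b]).
    by have := mulr_gt0 (pos a) (pos b); congr (_ < _); ring.
  by rewrite nmulr_lgt0.
have h_n0 : h != 0 by apply: contraTneq hab => ->; rewrite !horner0 mul0r ltxx.
have p_n0 : p != 0 by rewrite -size_poly_gt0 ltnW.
have sh : (size h < size p)%N.
  have := congr1 (fun q : {poly D} => size q) hE; rewrite size_mul //.
  have := size_polyD 1 g'; rewrite size_poly1.
  move: sg' p1; set u := size _; set v := size _; set w := size _; set t := size _.
  by lia.
have [q [irq qh qab]] := sign_change_factor hab.
apply: (IHn q g' _ irq qab Hg'); last by rewrite hE dvdp_mulr.
by rewrite (leq_ltn_trans (dvdp_leq h_n0 qh)) // (leq_trans sh).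
Qed.
End SignChangeExtension.

Lemma ordered_field (k : fieldType) (P : set k) : cone P ->
  exists (D : realFieldType) (e : {rmorphism D -> k}),
    (forall x, 0 <= x <-> P (e x)) /\ (forall u, exists x, e x = u).
Proof.
move=> [HP totP].
pose le (x y : k) := `[< P (y - x) >].
pose nrm (x : k) := if le 0 x then x else - x.
have leP x : reflect (P x) (le 0 x) by rewrite /le subr0; apply: asboolP.
have le_add x y : le 0 x -> le 0 y -> le 0 (x + y).
  by move=> /leP Px /leP Py; apply/leP/(preconeD HP).
have le_mul x y : le 0 x -> le 0 y -> le 0 (x * y).
  by move=> /leP Px /leP Py; apply/leP/(preconeM HP).
have le_anti x : le 0 x -> le x 0 -> x = 0.
  by move=> /leP Px /asboolP; rewrite sub0r; apply: (precone_anti HP).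
have le_sub x y : le 0 (y - x) = le x y by rewrite /le subr0.
have le_tot x : le 0 x || le x 0.
  case: (totP x) => Px; apply/orP; [left; exact/leP|right].
  by apply/asboolP; rewrite sub0r.
have nrmN x : nrm (- x) = nrm x.
  rewrite /nrm; case: (leP x) => Px; case: (leP (- x)) => PN; rewrite ?opprK //.
    by have := precone_anti HP Px PN => ->; rewrite oppr0.
  by case: (totP x).
have nrm_ge0 x : le 0 x -> nrm x = x by rewrite /nrm => ->.
have lt_def x y : (fun x y => (y != x) && le x y) x y = (y != x) && le x y by [].
pose m := Num.IntegralDomain_isLeReal.Build k le_add le_mul le_anti le_sub le_tot
  nrmN nrm_ge0 lt_def.
pose D : realFieldType := HB.pack k m.
by exists D, (idfun : {rmorphism k -> k}); split=> [x|u]; [split=> /leP|exists u].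
Qed.

Definition alg_ext (k F : fieldType) (j : {rmorphism k -> F}) (a : F) : set F :=
  [set x | exists f : {poly k}, x = (map_poly j f).[a]].

Lemma irreducible_coprime (k : fieldType) (p f : {poly k}) :
  irreducible_poly p -> ~~ (p %| f) -> coprimep p f.
Proof.
move=> irr npf; rewrite /coprimep; apply: contraNT npf => g1.
have := irr _ g1 (dvdp_gcdl p f); rewrite /eqp => /andP[_ pg].
exact: dvdp_trans pg (dvdp_gcdr p f).
Qed.

Section AlgExt.
Variables (k F : fieldType) (j : {rmorphism k -> F}) (a : F) (p : {poly k}).
Hypotheses (irr : irreducible_poly p) (pa : root (map_poly j p) a).

Lemma irreducible_root f : root (map_poly j f) a = (p %| f).
Proof.
apply/idP/idP => [fa|/dvdpP[q ->]]; last by rewrite rmorphM rootM pa orbT.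
apply: contraTT isT => /(irreducible_coprime irr)/Bezout_eq1_coprimepP[[u v] /= E].
have := congr1 (fun q => (map_poly j q).[a]) E.
rewrite rmorphD !rmorphM /= rmorph1 hornerD !hornerM hornerC.
move: pa fa; rewrite /root => /eqP-> /eqP->; rewrite !mulr0 addr0 => /eqP.
by rewrite eq_sym oner_eq0.
Qed.

Lemma alg_ext_subfield : is_subfield (alg_ext j a).
Proof.
split.
- by exists 1; rewrite rmorph1 hornerC.
- by move=> _ _ [f ->] [g ->]; exists (f - g); rewrite rmorphB hornerD hornerN.
move=> _ _ [f ->] [g ->].
have [->|ga] := eqVneq (map_poly j g).[a] 0.
  by exists 0; rewrite invr0 mulr0 rmorph0 horner0.
have : ~~ (p %| g) by rewrite -irreducible_root.
move=> /(irreducible_coprime irr)/Bezout_eq1_coprimepP[[u v] /= E].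
exists (f * v); rewrite rmorphM hornerM; congr (_ * _).
have := congr1 (fun q => (map_poly j q).[a]) E.
rewrite rmorphD !rmorphM /= rmorph1 hornerD !hornerM hornerC.
move: pa; rewrite /root => /eqP->; rewrite mulr0 add0r => vg.
by apply: (mulIf ga); rewrite vg mulVf.
Qed.
End AlgExt.

(* The nonnegative elements of a subfield [Q `|` - Q] of [F] ordered in some way. *)
Definition subcone (F : fieldType) (Q : set F) :=
  [/\ Q 1, forall x y, Q x -> Q y -> Q (x + y) /\ Q (x * y), forall x, Q x -> Q x^-1,
      ~ Q (-1) & forall x y, Q x -> Q y -> Q (x - y) \/ Q (y - x)].

Section Subcone.
Variables (F : fieldType) (Q : set F).
Hypothesis HQ : subcone Q.

Lemma subcone_subfield : is_subfield [set x | Q x \/ Q (- x)].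
Proof.
case: HQ => Q1 QDM QV QN1 QB.
have QD x y : Q x -> Q y -> Q (x + y) by move=> Qx Qy; case: (QDM _ _ Qx Qy).
have QM x y : Q x -> Q y -> Q (x * y) by move=> Qx Qy; case: (QDM _ _ Qx Qy).
split; first by left.
  move=> x y [Qx|Qx] [Qy|Qy] /=; rewrite ?opprB.
  - exact: QB.
  - by left; apply: QD.
  - by right; apply: QD.
  - by have := QB _ _ Qx Qy; rewrite !opprK ![- _ + _]addrC => -[]; [right|left].
move=> x y [Qx|Qx] [Qy|Qy] /=.
- by left; apply: QM => //; apply: QV.
- by right; rewrite -mulrN -invrN; apply: QM => //; apply: QV.
- by right; rewrite -mulNr; apply: QM => //; apply: QV.
- by left; rewrite -mulrNN -invrN; apply: QM => //; apply: QV.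
Qed.
End Subcone.

(** The order of [D] extends to [D(al)] because -1 is not a sum of squares there with nonnegative
    weights from [D]: lifted to polynomials modulo [p], such an identity is excluded by
    [sign_change_wsos]. *)
Lemma subcone_ext (D : realFieldType) (C : fieldType) (j : {rmorphism D -> C})
    (p : {poly D}) (a b : D) (al : C) :
  irreducible_poly p -> p.[a] * p.[b] < 0 -> root (map_poly j p) al ->
  exists Q : set C, [/\ subcone Q, forall c, 0 <= c -> Q (j c) & Q al \/ Q (- al)].
Proof.
move=> irr pab pal.
have HE := alg_ext_subfield irr pal.
have [k [e He]] := subfield_type HE.
pose P : set k := [set u | exists2 c, 0 <= c & e u = j c].
have in_k x : alg_ext j al x -> exists u, e u = x by move/He.
have jE c : alg_ext j al (j c) by exists c%:P; rewrite map_polyC hornerC.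
have rep x : wsos P x -> exists2 g, wsos (@nneg_const D) g & e x = (map_poly j g).[al].
  elim=> [|q f y [c c0 Eq] _ [g Hg Eg]].
    by exists 0; [exact: wsos0|rewrite !rmorph0 horner0].
  have [h Eh] : alg_ext j al (e f) by apply/He; exists f.
  exists (c%:P * h ^+ 2 + g); first by apply: wsosS => //; exists c.
  by rewrite !rmorphD /= !rmorphM /= map_polyC hornerD !hornerM hornerC Eq Eh Eg.
have [|R [[HR totR] TR]] := @cone_extend k (wsos P).
  apply: wsos_precone.
  - by exists 1; rewrite ?ler01 // !rmorph1.
  - move=> u v [c c0 Eu] [d d0 Ev]; exists (c * d); first exact: mulr_ge0.
    by rewrite !rmorphM Eu Ev.
  move=> /rep[g Hg E]; apply: (sign_change_wsos irr pab Hg).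
  rewrite -(irreducible_root irr pal) /root rmorphD rmorph1 hornerD hornerC -E.
  by rewrite rmorphN rmorph1 subrr.
exists (e @` R); split.
- split.
  + by exists 1; rewrite ?rmorph1 //; apply: precone1.
  + move=> _ _ [x Rx <-] [y Ry <-]; split.
      by exists (x + y); rewrite ?rmorphD //; apply: preconeD.
    by exists (x * y); rewrite ?rmorphM //; apply: preconeM.
  + by move=> _ [x Rx <-]; exists x^-1; rewrite ?fmorphV //; apply: preconeV.
  + case=> x Rx /eqP; rewrite -(rmorphN1 e) (inj_eq (fmorph_inj e)) => /eqP xE.
    by apply: (preconeN1 HR); rewrite -xE.
  move=> _ _ [x Rx <-] [y Ry <-]; case: (totR (x - y)) => Rxy; [left|right].
    by exists (x - y); rewrite ?rmorphB.
  by exists (y - x); rewrite ?rmorphB // -opprB.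
- move=> c c0; have [u Eu] := in_k _ (jE c); exists u => //.
  by apply/TR/wsos_in; exists c.
have [|u <-] := in_k al; first by exists 'X; rewrite map_polyX hornerX.
by case: (totR u) => Ru; [left|right]; [exists u|exists (- u); rewrite ?rmorphN].
Qed.

(** A maximal ordered subfield of an algebraically closed field is real closed: an irreducible
    polynomial changing sign has a root in [C], the order extends to that root, and maximality puts
    it in the subfield. *)
Lemma closed_field_rcf (C : closedFieldType) (Q0 : set C) : subcone Q0 ->
  exists (D : rcfType) (j : {rmorphism D -> C}), forall x, Q0 x -> exists2 u, 0 <= u & j u = x.
Proof.
move=> HQ0.
have [||G [X0 GX0] GC totG|Q [[HQ Q0Q] maxQ]] :=
  @Zorn_above C [set Q | subcone Q /\ Q0 `<=` Q] Q0.
- by split.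
- by exists 1; case: HQ0.
- split; last by move=> x Tx; exists X0 => //; case: (GC _ GX0) => _; apply.
  have pair x y : (\bigcup_(X in G) X) x -> (\bigcup_(X in G) X) y ->
      exists X, [/\ G X, subcone X, X x & X y].
    move=> [X GX Xx] [Y GY Yy]; have [XY|YX] := totG _ _ GX GY.
      by exists Y; split=> //; [case: (GC _ GY)|apply: XY].
    by exists X; split=> //; [case: (GC _ GX)|apply: YX].
  split.
  + by exists X0 => //; case: (GC _ GX0) => -[].
  + move=> x y /pair/[apply] -[X [GX [_ XDM _ _ _] Xx Xy]].
    by have [? ?] := XDM _ _ Xx Xy; split; exists X.
  + by move=> x [X GX Xx]; exists X => //; case: (GC _ GX) => -[_ _ XV _ _] _; apply: XV.
  + by case=> X GX; case: (GC _ GX) => -[].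
  + move=> x y /pair/[apply] -[X [GX [_ _ _ _ XB] Xx Xy]].
    by have [?|?] := XB _ _ Xx Xy; [left|right]; exists X.
have [k [e He]] := subfield_type (subcone_subfield HQ).
have [Q1 QDM QV QN1 QB] := HQ.
have QD x y : Q x -> Q y -> Q (x + y) by move=> Qx Qy; case: (QDM _ _ Qx Qy).
have QM x y : Q x -> Q y -> Q (x * y) by move=> Qx Qy; case: (QDM _ _ Qx Qy).
have Hk u : Q (e u) \/ Q (- e u) by apply/He; exists u.
have [|D [i [iP isurj]]] := @ordered_field k [set u | Q (e u)].
  split; last by move=> u; rewrite /= rmorphN; apply: Hk.
  split=> [u|u v|u v|] /=.
  - by rewrite rmorphXn /= expr2; case: (Hk u) => Qu; [|rewrite -mulrNN]; apply: QM.
  - by rewrite rmorphD; apply: QD.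
  - by rewrite rmorphM; apply: QM.
  - by rewrite rmorphN1.
pose j : {rmorphism D -> C} := (e \o i)%FUN.
have jP c : 0 <= c -> Q (j c) by move/iP.
have ivt : Num.real_closed_axiom D.
  move=> p a b le_ab /andP[pa pb].
  have [pa0|pa0] := eqVneq p.[a] 0; first by exists a; rewrite ?lexx //; apply/eqP.
  have [pb0|pb0] := eqVneq p.[b] 0; first by exists b; rewrite ?lexx ?le_ab //; apply/eqP.
  have pab : p.[a] * p.[b] < 0.
    have pa' : p.[a] < 0 by rewrite lt_neqAle pa0.
    by rewrite nmulr_rlt0 // lt_neqAle eq_sym pb0.
  have [g [irr gp gab]] := sign_change_factor pab.
  have [al gal] : exists al, root (map_poly j g) al.
    apply/closed_rootP; rewrite size_map_poly neq_ltn; apply/orP; right.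
    by case: irr.
  have [R [HR jR Ral]] := subcone_ext irr gab gal.
  have QR : Q `<=` R.
    move=> x Qx; have [u eu] : exists u, e u = x by apply/He; left.
    have [c ic] := isurj u; have -> : x = j c by rewrite /= ic.
    by apply: jR; apply/iP; rewrite /= ic eu.
  have RQ : R `<=` Q by apply: maxQ => //; split=> // x /Q0Q /QR.
  have [u eu] : exists u, e u = al by apply/He; case: Ral => /RQ; [left|right].
  have [c ic] := isurj u; have jc : j c = al by rewrite /= ic.
  have gc : root g c by move: gal; rewrite -jc /root horner_map fmorph_eq0.
  (* Irreducible with a root, [g] is linear, and its sign change places the root between [a] and
     [b]. *)
  have Xg : 'X - c%:P %| g by rewrite dvdp_XsubCl.
  have [s [t [s0 t0 E]]] : exists s t : D, [/\ s != 0, t != 0 & s *: ('X - c%:P) = t *: g].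
    have := irr.2 _ _ Xg; rewrite size_XsubC => /(_ isT)/eqpP[[s t] /= /andP[s0 t0] E].
    by exists s, t.
  have gE x : t * g.[x] = s * (x - c).
    by rewrite -hornerZ -E hornerZ hornerXsubC.
  have cab : (a - c) * (b - c) < 0.
    have : (t * g.[a]) * (t * g.[b]) < 0.
      have -> : (t * g.[a]) * (t * g.[b]) = t ^+ 2 * (g.[a] * g.[b]) by ring.
      by rewrite pmulr_rlt0 //; rewrite lt_neqAle sqr_ge0 eq_sym sqrf_eq0 t0.
    rewrite !gE; have -> : s * (a - c) * (s * (b - c)) = s ^+ 2 * ((a - c) * (b - c)) by ring.
    have s2 : 0 < s ^+ 2 by rewrite lt_neqAle sqr_ge0 eq_sym sqrf_eq0 s0.
    by rewrite (pmulr_rlt0 _ s2).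
  exists c; last first.
    by have [h ->] := dvdpP _ _ gp; rewrite rootM gc orbT.
  case: (leP a c) => ac; case: (leP c b) => cb //=; move: cab; rewrite ltNge => /negP[].
  - by rewrite mulr_le0 // subr_le0 // ltW.
  - by rewrite mulr_ge0 // subr_ge0 // ltW.
  - by move: (lt_le_trans cb (ltW ac)); rewrite ltNge le_ab.
pose Dr : rcfType := HB.pack D (Num.RealField_isClosed.Build D ivt).
exists Dr, (j : {rmorphism Dr -> C}) => x Qx.
have [u eu] : exists u, e u = x by apply/He; left; apply: Q0Q.
have [c ic] := isurj u; exists c; last by rewrite /= ic.
by apply/iP; rewrite /= ic eu; apply: Q0Q.
Qed.

Lemma factor_rmorphism (k D C : fieldType) (f : {rmorphism k -> C}) (j : {rmorphism D -> C}) :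
  (forall u, exists d, j d = f u) -> exists i : {rmorphism k -> D}, forall u, j (i u) = f u.
Proof.
move=> /choice[g jg].
have gB : {morph g : x y / x - y}.
  by move=> x y; apply: (fmorph_inj j); rewrite rmorphB !jg rmorphB.
have gM : monoid_morphism g.
  by split=> [|x y]; apply: (fmorph_inj j); rewrite ?rmorphM !jg ?rmorphM ?rmorph1.
pose G : {rmorphism k -> D} := HB.pack g (GRing.isZmodMorphism.Build k D g gB)
  (GRing.isMonoidMorphism.Build k D g gM).
by exists G.
Qed.

(** The ordered subfield found in the algebraic closure contains all of [k], since every element of
    [k] is in [P] up to sign. *)
Lemma real_closure (k : countFieldType) (P : set k) : cone P ->
  exists (D : rcfType) (i : {rmorphism k -> D}), forall x, P x -> 0 <= i x.
Proof.
move=> [HP totP]; have [C [f _]] := countable_algebraic_closure k.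
have HQ : subcone (f @` P).
  split.
  - by exists 1; rewrite ?rmorph1 //; apply: precone1.
  - move=> _ _ [x Rx <-] [y Ry <-]; split.
      by exists (x + y); rewrite ?rmorphD //; apply: preconeD.
    by exists (x * y); rewrite ?rmorphM //; apply: preconeM.
  - by move=> _ [x Rx <-]; exists x^-1; rewrite ?fmorphV //; apply: preconeV.
  - case=> x Rx /eqP; rewrite -(rmorphN1 f) (inj_eq (fmorph_inj f)) => /eqP xE.
    by apply: (preconeN1 HP); rewrite -xE.
  move=> _ _ [x Rx <-] [y Ry <-]; case: (totP (x - y)) => Rxy; [left|right].
    by exists (x - y); rewrite ?rmorphB.
  by exists (y - x); rewrite ?rmorphB // -opprB.
have [D [j jP]] := closed_field_rcf HQ.
have [u|i jE] := @factor_rmorphism _ _ _ f j.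
  case: (totP u) => Pu; first by have [|d _ jd] := jP (f u); [exists u|exists d].
  have [|d _ jd] := jP (f (- u)); first by exists (- u).
  by exists (- d); rewrite rmorphN jd rmorphN opprK.
exists D, i => x Px; have [|d d0 jd] := jP (f x); first by exists x.
suff <- : d = i x by [].
by apply: (fmorph_inj j); rewrite jE.
Qed.

(** * Continuity of roots *)

Section Near.
Variable R : rcfType.

Lemma poly_near (f0 : {poly R}) y0 e : 0 < e ->
  exists2 d, 0 < d & forall (f : {poly R}) y, (size f <= size f0)%N ->
    (forall i, `|f`_i - f0`_i| < d) -> `|y - y0| < d -> `|f.[y] - f0.[y0]| < e.
Proof.
move=> e0; have e2 : 0 < e / 2 by rewrite divr_gt0.
have [d1 d1_0 H1] := poly_cont y0 f0 e2.
pose M := \sum_(i < size f0) (`|y0| + 1) ^+ i.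
have M0 : 0 <= M by apply: sumr_ge0 => i _; rewrite exprn_ge0 // addr_ge0.
have M1 : 0 < M + 1 by rewrite ltr_wpDl.
(* Moving the point costs less than [e / 2] by continuity of [f0]; changing the coefficients by less
   than [d] costs at most [d M] as long as [y] is within 1 of [y0]. *)
exists (Num.min (Num.min d1 1) (e / 2 / (M + 1))).
  by rewrite !lt_min d1_0 ltr01 /= divr_gt0.
move=> f y sf Hf; rewrite !lt_min => /andP[/andP[yd1 y1] _].
have -> : f.[y] - f0.[y0] = (f.[y] - f0.[y]) + (f0.[y] - f0.[y0]) by ring.
rewrite (le_lt_trans (ler_normD _ _)) //.
suff : `|f.[y] - f0.[y]| <= e / 2 by have := H1 _ yd1; lra.
have -> : f.[y] - f0.[y] = \sum_(i < size f0) (f`_i - f0`_i) * y ^+ i.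
  rewrite (horner_coef_wide _ sf) horner_coef -sumrB.
  by apply: eq_bigr => i _; rewrite mulrBl.
rewrite (le_trans (ler_norm_sum _ _ _)) //.
apply: (@le_trans _ _ (\sum_(i < size f0) e / 2 / (M + 1) * (`|y0| + 1) ^+ i)).
  apply: ler_sum => i _; rewrite normrM normrX ler_pM ?exprn_ge0 //.
    by have := Hf i; rewrite !lt_min => /andP[_ /ltW].
  rewrite lerXn2r ?nnegrE ?addr_ge0 //.
  have -> : y = y0 + (y - y0) by ring.
  by rewrite (le_trans (ler_normD _ _)) // lerD2l ltW.
rewrite -mulr_sumr -/M -mulrA ler_piMr ?(ltW e2) // mulrC ler_pdivrMr // mul1r.
by rewrite lerDl.
Qed.

Lemma div_near (a0 b0 : R) e : 0 < e -> b0 != 0 ->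
  exists2 d, 0 < d & forall a b, `|a - a0| < d -> `|b - b0| < d ->
    b != 0 /\ `|a / b - a0 / b0| < e.
Proof.
move=> e0 b0n0; have nb : 0 < `|b0| by rewrite normr_gt0.
pose M := `|a0| + `|b0|; have M0 : 0 < M by rewrite ltr_wpDl.
(* The first bound keeps [|b|] above [|b0| / 2]; the second keeps the numerator of the difference of
   the fractions below [e |b0|^2 / 2]. *)
exists (Num.min (`|b0| / 2) (e * `|b0| ^+ 2 / (2 * M))).
  by rewrite lt_min !divr_gt0 ?mulr_gt0 ?exprn_gt0.
move=> a b; rewrite !lt_min => /andP[_ ha] /andP[hb1 hb].
have lb : `|b0| / 2 < `|b|.
  have : `|b0| <= `|b| + `|b - b0|.
    by have := ler_normD b (b0 - b); rewrite (addrC b) subrK (distrC b0).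
  by lra.
have bn0 : b != 0 by rewrite -normr_gt0 (le_lt_trans _ lb) // divr_ge0.
split=> //.
have -> : a / b - a0 / b0 = ((a - a0) * b0 - a0 * (b - b0)) / (b * b0).
  by field; rewrite bn0 b0n0.
rewrite normrM normfV normrM ltr_pdivrMr ?mulr_gt0 ?normr_gt0 //.
apply: (@lt_le_trans _ _ (e * `|b0| ^+ 2 / 2)).
  have -> : e * `|b0| ^+ 2 / 2 = e * `|b0| ^+ 2 / (2 * M) * `|b0| + `|a0| * (e * `|b0| ^+ 2 / (2 * M)).
    rewrite -/M /M; field; rewrite gt_eqF //.
  rewrite (le_lt_trans (ler_normB _ _)) // !normrM ltr_leD ?ltr_pM2r //.
  by rewrite ler_wpM2l // ltW.
have -> : e * `|b0| ^+ 2 / 2 = e * (`|b0| / 2 * `|b0|) by field.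
by rewrite ler_pM2l // ler_pM2r // ltW.
Qed.

(** At a simple root [p] changes sign, and opposite signs at two fixed points survive small changes
    of the coefficients. *)
Lemma near_root (p : {poly R}) y0 e : 0 < e -> root p y0 -> ~~ root p^`() y0 ->
  exists2 d, 0 < d & forall (f : {poly R}), (size f <= size p)%N ->
    (forall i, `|f`_i - p`_i| < d) -> exists2 y, `|y - y0| < e & root f y.
Proof.
move=> e0 /factor_theorem[q pE] p'y.
have qy : q.[y0] != 0.
  move: p'y; rewrite /root pE derivM derivXsubC mulr1 hornerD hornerM hornerXsubC subrr.
  by rewrite mulr0 add0r.
have nq : 0 < `|q.[y0]| by rewrite normr_gt0.
have [d d0 qd] := poly_cont y0 q nq.
pose h := Num.min d e / 2.
have h0 : 0 < h by rewrite divr_gt0 // lt_min d0.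
have hd : h < d by rewrite /h; case: (leP d e); lra.
have he : h < e by rewrite /h; case: (leP d e); lra.
have qs y : `|y - y0| < d -> 0 < q.[y] * q.[y0].
  move=> /qd; case: (ltrP q.[y0] 0) => q0; [rewrite (ltr0_norm q0)|rewrite (ger0_norm q0)].
    by rewrite ltr_norml => /andP[_]; rewrite nmulr_lgt0 //; lra.
  by rewrite ltr_norml => /andP[+ _]; rewrite pmulr_lgt0 ?lt_neqAle ?[0 == _]eq_sym ?qy //; lra.
have pab : p.[y0 - h] * p.[y0 + h] < 0.
  have q1 : 0 < q.[y0 - h] * q.[y0] by apply: qs; rewrite addrAC subrr add0r normrN gtr0_norm.
  have q2 : 0 < q.[y0 + h] * q.[y0] by apply: qs; rewrite addrAC subrr add0r gtr0_norm.
  have : 0 < (q.[y0 - h] * q.[y0 + h]) * q.[y0] ^+ 2.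
    by have := mulr_gt0 q1 q2; congr (_ < _); ring.
  have qy2 : 0 < q.[y0] ^+ 2 by rewrite lt_neqAle sqr_ge0 eq_sym sqrf_eq0 qy.
  rewrite (pmulr_lgt0 _ qy2) => q12.
  rewrite pE !hornerM !hornerXsubC.
  have -> : q.[y0 - h] * (y0 - h - y0) * (q.[y0 + h] * (y0 + h - y0)) =
            - (q.[y0 - h] * q.[y0 + h] * h ^+ 2) by ring.
  by rewrite oppr_lt0 mulr_gt0 // exprn_gt0.
have pn : forall c, p.[c] != 0 -> exists2 d', 0 < d' & forall (f : {poly R}), (size f <= size p)%N ->
    (forall i, `|f`_i - p`_i| < d') -> 0 < f.[c] * p.[c].
  move=> c pc; have np : 0 < `|p.[c]| by rewrite normr_gt0.
  have [d' d'0 H] := poly_near p c np.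
  exists d' => // f sf /(H f c sf); rewrite subrr normr0 => /(_ d'0).
  case: (ltrP p.[c] 0) => q0; [rewrite (ltr0_norm q0)|rewrite (ger0_norm q0)].
    by rewrite ltr_norml => /andP[_]; rewrite nmulr_lgt0 //; lra.
  by rewrite ltr_norml => /andP[+ _]; rewrite pmulr_lgt0 ?lt_neqAle ?[0 == _]eq_sym ?pc //; lra.
have [pa pb] : p.[y0 - h] != 0 /\ p.[y0 + h] != 0.
  by split; apply: contraTneq pab => ->; rewrite ?mul0r ?mulr0 ltxx.
have [d1 d10 H1] := pn _ pa; have [d2 d20 H2] := pn _ pb.
exists (Num.min d1 d2); first by rewrite lt_min d10.
move=> f sf Hf.
have f1 : 0 < f.[y0 - h] * p.[y0 - h].
  by apply: H1 => // i; have := Hf i; rewrite lt_min => /andP[].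
have f2 : 0 < f.[y0 + h] * p.[y0 + h].
  by apply: H2 => // i; have := Hf i; rewrite lt_min => /andP[].
have fab : f.[y0 - h] * f.[y0 + h] < 0.
  have : 0 < (f.[y0 - h] * f.[y0 + h]) * (p.[y0 - h] * p.[y0 + h]).
    by have := mulr_gt0 f1 f2; congr (_ < _); ring.
  by rewrite nmulr_lgt0.
have [|y yab fy] := poly_ivtoo _ fab; first by lra.
exists y => //; move: yab; rewrite in_itv /= => /andP[? ?].
by rewrite ltr_norml; apply/andP; split; lra.
Qed.
End Near.

(** * Finitely generated subfields *)

(** Cantor's argument: nested intervals, the n-th step excluding the roots of [f n], have a common
    point by completeness. *)
Lemma avoid_roots (R : realType) (f : nat -> {poly R}) (a b : R) :
  (forall n, f n != 0) -> a < b ->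
  exists2 y, a < y < b & forall n, ~~ root (f n) y.
Proof.
move=> f0 ab.
have step (n : nat) (I : R * R) : exists J : R * R, I.1 < I.2 ->
    [/\ I.1 < J.1, J.1 < J.2, J.2 < I.2 & forall y, J.1 <= y <= J.2 -> ~~ root (f n) y].
  case: (ltP I.1 I.2) => [lt_I|_]; last by exists I.
  pose c := next_root (f n) I.1 I.2.
  have Ic : I.1 < c by apply: next_root_gt.
  have cI : c <= I.2.
    by have := next_root_in (f n) I.1 I.2; rewrite -/c in_itv /= (max_idPl (ltW lt_I)) => /andP[].
  (* There is no root strictly between [I.1] and [c]; the quarter and half points stay inside this
     gap. *)
  exists (I.1 + (c - I.1) / 4, I.1 + (c - I.1) / 2) => _ /=; split; try lra.
  move=> y /andP[y1 y2]; apply: (@neighpr_root _ _ I.1 I.2).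
  by rewrite /neighpr -/c in_itv /=; apply/andP; split; lra.
have [h Hh] := choice (fun nI : nat * (R * R) => step nI.1 nI.2).
pose g n I := h (n, I); have Hg n I := Hh (n, I).
pose I := fix I n : R * R := if n is m.+1 then g m (I m) else (a, b).
have lt_I n : (I n).1 < (I n).2.
  by elim: n => //= n IHn; case: (Hg n _ IHn).
have S1 n : (I n).1 < (I n.+1).1 by case: (Hg n _ (lt_I n)).
have S2 n : (I n.+1).2 < (I n).2 by case: (Hg n _ (lt_I n)).
have mono1 m d : (I m).1 <= (I (m + d)%N).1.
  by elim: d => [|d IHd]; rewrite ?addn0 // addnS (le_trans IHd) // ltW.
have mono2 m d : (I (m + d)%N).2 <= (I m).2.
  by elim: d => [|d IHd]; rewrite ?addn0 // addnS (le_trans _ IHd) // ltW.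
have cross m n : (I m).1 <= (I n).2.
  have [mn|nm] := leqP m n.
    rewrite -(subnKC mn) (le_trans (mono1 _ (n - m)%N)) // ltW //.
  by rewrite -(subnKC (ltnW nm)) (le_trans _ (mono2 _ (m - n)%N)) // ltW.
pose E := [set x | exists n, x = (I n).1].
have E0 : E !=set0 by exists a, 0%N.
have ubE n : ubound E (I n).2 by move=> _ [m ->].
have Esup n : (I n).1 <= sup E by apply: ub_le_sup; [exists b; apply: (ubE 0%N)|exists n].
have supE n : sup E <= (I n).2 by apply: ge_sup.
exists (sup E).
  by rewrite (lt_le_trans (S1 0%N) (Esup 1%N)) (le_lt_trans (supE 1%N) (S2 0%N)).
move=> n; case: (Hg n _ (lt_I n)) => _ _ _; apply.
by rewrite (Esup n.+1) (supE n.+1).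
Qed.

Section Gen.
Variable F : fieldType.
Implicit Types (K : set F) (l : seq F).

Definition gen l : set F :=
  [set x | forall K, is_subfield K -> (forall y, y \in l -> K y) -> K x].

Lemma gen_subfield l : is_subfield (gen l).
Proof.
split=> [K HK lK|x y gx gy K HK lK|x y gx gy K HK lK].
- exact: subfield1.
- by apply: (subfieldB HK); [exact: gx|exact: gy].
- by apply: (subfieldM HK); [exact: gx|apply: (subfieldV HK); exact: gy].
Qed.

Lemma mem_gen l x : x \in l -> gen l x.
Proof. by move=> xl K _; apply. Qed.

Lemma gen_min l K : is_subfield K -> (forall y, y \in l -> K y) -> gen l `<=` K.
Proof. by move=> HK lK x; apply. Qed.

Lemma gen_sub l1 l2 : {subset l1 <= l2} -> gen l1 `<=` gen l2.
Proof. by move=> s; apply: gen_min (gen_subfield l2) _ => y /s; apply: mem_gen. Qed.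

Definition coefs_in K (f : {poly F}) := forall i, K f`_i.

Lemma coefs_in_lift K (k : fieldType) (j : {rmorphism k -> F}) (f : {poly F}) :
  (forall x, K x <-> exists u, j u = x) -> coefs_in K f -> exists g, f = map_poly j g.
Proof.
move=> Kj Kf; have H i : exists u, j u = f`_i by apply/Kj.
have [g gE] := choice H.
exists (\poly_(i < size f) g i); apply/polyP => i; rewrite coef_map coef_poly.
case: ltnP => [_|le] /=; first by rewrite -gE.
by rewrite rmorph0 nth_default.
Qed.

Lemma coefs_in_map K (k : fieldType) (j : {rmorphism k -> F}) (g : {poly k}) :
  (forall u, K (j u)) -> coefs_in K (map_poly j g).
Proof. by move=> Kj i; rewrite coef_map; apply: Kj. Qed.

(** The field k(a). Since [x / 0 = 0], a vanishing denominator gives 0 and needs no side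
    condition. *)
Definition adj (k : fieldType) (j : {rmorphism k -> F}) (a : F) : set F :=
  [set x | exists f g : {poly k}, x = (map_poly j f).[a] / (map_poly j g).[a]].

Lemma adj_subfield (k : fieldType) (j : {rmorphism k -> F}) a : is_subfield (adj j a).
Proof.
split.
- by exists 1, 1; rewrite rmorph1 hornerC divr1.
- move=> _ _ [f [g ->]] [f' [g' ->]].
  have [->|ga] := eqVneq (map_poly j g).[a] 0.
    by exists (- f'), g'; rewrite invr0 mulr0 sub0r rmorphN hornerN mulNr.
  have [->|ga'] := eqVneq (map_poly j g').[a] 0.
    by exists f, g; rewrite invr0 mulr0 subr0.
  exists (f * g' - f' * g), (g * g').
  rewrite rmorphB !rmorphM /= hornerD hornerN !hornerM; field.
  by rewrite ga ga'.
- move=> _ _ [f [g ->]] [f' [g' ->]].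
  by exists (f * g'), (g * f'); rewrite !rmorphM !hornerM invf_div mulf_div.
Qed.

Lemma gen_cons l a (k : fieldType) (j : {rmorphism k -> F}) :
  (forall x, gen l x <-> exists u, j u = x) -> gen (a :: l) = adj j a.
Proof.
move=> lj; apply/seteqP; split.
  apply: gen_min; first exact: adj_subfield.
  move=> y; rewrite inE => /orP[/eqP->|yl].
    by exists 'X, 1; rewrite map_polyX hornerX rmorph1 hornerC divr1.
  have [u <-] : exists u, j u = y by apply/lj; apply: mem_gen.
  by exists u%:P, 1; rewrite map_polyC rmorph1 !hornerC divr1.
have jl u : gen (a :: l) (j u).
  by apply: (@gen_sub l) => [x xl|]; [rewrite inE xl orbT|apply/lj; exists u].
have ga : gen (a :: l) a by apply: mem_gen; rewrite mem_head.
have HK := gen_subfield (a :: l).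
have poly_in f : gen (a :: l) (map_poly j f).[a].
  elim/poly_ind: f => [|f c IHf]; first by rewrite rmorph0 horner0; exact: (subfield0 HK).
  rewrite rmorphD rmorphM /= map_polyX map_polyC hornerD hornerM hornerX hornerC.
  exact: (subfieldD HK (subfieldM HK IHf ga) (jl c)).
by move=> _ [f [g ->]]; exact: (subfieldM HK (poly_in f) (subfieldV HK (poly_in g))).
Qed.

Lemma countable_type (k : fieldType) (T : countType) (s : T -> k) :
  (forall u, exists t, s t = u) ->
  exists (c : countFieldType) (e : {rmorphism c -> k}), forall u, exists v, e v = u.
Proof.
move=> /choice[g gK].
have pK : pcancel (fun u => pickle (g u)) (fun n => omap s (unpickle n)).
  by move=> u; rewrite pickleK /= gK.
pose m := isCountable.Build k pK.
pose c : countFieldType := HB.pack k m.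
by exists c, (idfun : {rmorphism k -> k}) => u; exists u.
Qed.

(** Over a countable field [k], the elements of k(a) are indexed by pairs of polynomials, so
    countability survives each new generator. *)
Lemma gen_countable (j0 : {rmorphism rat -> F}) l :
  exists (k : countFieldType) (j : {rmorphism k -> F}), forall x, gen l x <-> exists u, j u = x.
Proof.
elim: l => [|a l [k [j lj]]].
  exists rat, j0 => x; split=> [|[u <-]].
    apply: (gen_min (K := [set y | exists u, j0 u = y])) => //; split=> [|_ _ [u <-] [v <-]|_ _ [u <-] [v <-]].
    - by exists 1; rewrite rmorph1.
    - by exists (u - v); rewrite rmorphB.
    - by exists (u / v); rewrite fmorph_div.
  have HK := gen_subfield [::].
  have Kn n : gen [::] (j0 n%:R).
    elim: n => [|n IHn]; first by rewrite rmorph0; exact: (subfield0 HK).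
    by rewrite -natr1 rmorphD rmorph1; exact: (subfieldD HK IHn (subfield1 HK)).
  have Kz z : gen [::] (j0 z%:~R).
    by case: z => n; [exact: Kn|rewrite NegzE mulrNz rmorphN; exact: (subfieldN HK (Kn _))].
  by rewrite -[u]divq_num_den fmorph_div; exact: (subfieldM HK (Kz _) (subfieldV HK (Kz _))).
have [k' [j' lj']] := subfield_type (gen_subfield (a :: l)).
have adjE := gen_cons a lj.
have Hs (t : {poly k} * {poly k}) : exists u, j' u = (map_poly j t.1).[a] / (map_poly j t.2).[a].
  by apply/lj'; rewrite adjE; exists t.1, t.2.
have [s sE] := choice Hs.
have [|c [e ce]] := @countable_type k' _ s.
  move=> u; have : gen (a :: l) (j' u) by apply/lj'; exists u.
  rewrite adjE => -[f [g E]]; exists (f, g); apply: (fmorph_inj j').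
  by rewrite sE E.
exists c, (j' \o e)%FUN => x; split=> [/lj'[u <-]|[v <-]]; last by apply/lj'; exists (e v).
by have [v <-] := ce u; exists v.
Qed.
End Gen.

(** * Homomorphisms defined on a subfield *)

(** A total function with arbitrary values outside [K], so that the domain can vary without changing
    the type. *)
Definition hom_on (F L : fieldType) (K : set F) (psi : F -> L) :=
  [/\ psi 1 = 1, forall x y, K x -> K y -> psi (x - y) = psi x - psi y &
      forall x y, K x -> K y -> psi (x * y) = psi x * psi y].

Section HomOn.
Variables (F L : fieldType).
Implicit Types (K : set F) (psi : F -> L).

Lemma hom_on_sub K K' psi : K `<=` K' -> hom_on K' psi -> hom_on K psi.
Proof.
by move=> KK' [p1 pB pM]; split=> // x y /KK' Kx /KK' Ky; [exact: pB|exact: pM].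
Qed.

Lemma hom_on_rmorph K psi (k : fieldType) (j : {rmorphism k -> F}) :
  (forall u, K (j u)) -> hom_on K psi ->
  exists phi : {rmorphism k -> L}, forall u, phi u = psi (j u).
Proof.
move=> Kj [p1 pB pM]; pose g u := psi (j u).
have gB : {morph g : x y / x - y} by move=> x y; rewrite /g rmorphB pB.
have gM : monoid_morphism g by split=> [|x y]; rewrite /g ?rmorph1 ?rmorphM ?pM.
pose G : {rmorphism k -> L} := HB.pack g (GRing.isZmodMorphism.Build k L g gB)
  (GRing.isMonoidMorphism.Build k L g gM).
by exists G.
Qed.

Lemma rmorph_hom_on K (k : fieldType) (j : {rmorphism k -> F}) (phi : {rmorphism k -> L}) :
  (forall x, K x -> exists u, j u = x) ->
  exists2 psi, hom_on K psi & forall u, psi (j u) = phi u.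
Proof.
move=> Kj.
have H (x : F) : exists y, forall u, j u = x -> phi u = y.
  have [[u <-]|no] := pselect (exists u, j u = x).
    by exists (phi u) => v /fmorph_inj->.
  by exists 0 => u ju; case: no; exists u.
have [psi psiE] := choice H.
have E u : psi (j u) = phi u by rewrite (psiE (j u) u).
exists psi => //; split=> [|x y /Kj[u <-] /Kj[v <-]|x y /Kj[u <-] /Kj[v <-]].
- by rewrite -(rmorph1 j) E rmorph1.
- by rewrite -rmorphB !E rmorphB.
- by rewrite -rmorphM !E rmorphM.
Qed.

(** If the same polynomials vanish at [a] and at [y], substitution is well defined on fractions.
    This treats algebraic and transcendental [a] alike; zero denominators correspond and give 0 on
    both sides. *)
Lemma hom_on_adj (k : fieldType) (j : {rmorphism k -> F}) (phi : {rmorphism k -> L}) a y :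
  (forall f : {poly k}, root (map_poly j f) a = root (map_poly phi f) y) ->
  exists2 psi, hom_on (adj j a) psi & forall f g : {poly k},
    psi ((map_poly j f).[a] / (map_poly j g).[a]) = (map_poly phi f).[y] / (map_poly phi g).[y].
Proof.
move=> compat.
have H x : exists z, forall f g, x = (map_poly j f).[a] / (map_poly j g).[a] ->
    z = (map_poly phi f).[y] / (map_poly phi g).[y].
  have [[f [g xE]]|no] := pselect (adj j a x); last first.
    by exists 0 => f g xE; case: no; exists f, g.
  exists ((map_poly phi f).[y] / (map_poly phi g).[y]) => f' g'; rewrite {}xE.
  have z0 h : ((map_poly j h).[a] == 0) = ((map_poly phi h).[y] == 0) := compat h.
  have [ga|ga] := eqVneq (map_poly j g).[a] 0.
    have /eqP gy : (map_poly phi g).[y] == 0 by rewrite -z0 ga.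
    rewrite ga gy !invr0 !mulr0 => /esym/eqP; rewrite mulf_eq0 invr_eq0 !z0 => fg0.
    by apply/esym/eqP; rewrite mulf_eq0 invr_eq0.
  have [ga'|ga'] := eqVneq (map_poly j g').[a] 0.
    have /eqP gy' : (map_poly phi g').[y] == 0 by rewrite -z0 ga'.
    rewrite ga' gy' !invr0 !mulr0 => /eqP; rewrite mulf_eq0 invr_eq0 !z0 => fg0.
    by apply/eqP; rewrite mulf_eq0 invr_eq0.
  move=> /eqP; rewrite eqr_div // => /eqP E; apply/eqP.
  rewrite eqr_div -?z0 // -subr_eq0.
  have := z0 (f * g' - f' * g); rewrite !rmorphB !rmorphM !hornerD !hornerN !hornerM E subrr eqxx.
  by move=> /esym.
have [psi psiE] := choice H.
have E f g : psi ((map_poly j f).[a] / (map_poly j g).[a]) =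
   (map_poly phi f).[y] / (map_poly phi g).[y] by apply: psiE.
exists psi => //.
have z0 h : ((map_poly j h).[a] == 0) = ((map_poly phi h).[y] == 0) := compat h.
split.
- by have := E 1 1; rewrite !rmorph1 !hornerC !divr1.
- move=> _ _ [f [g ->]] [f' [g' ->]]; rewrite !E.
  have [ga|ga] := eqVneq (map_poly j g).[a] 0.
    have /eqP gy : (map_poly phi g).[y] == 0 by rewrite -z0 ga.
    rewrite ga gy !invr0 !mulr0 !sub0r -!mulNr -!hornerN -!rmorphN; exact: E.
  have [ga'|ga'] := eqVneq (map_poly j g').[a] 0.
    have /eqP gy' : (map_poly phi g').[y] == 0 by rewrite -z0 ga'.
    by rewrite ga' gy' !invr0 !mulr0 !subr0; exact: E.
  have := E (f * g' - f' * g) (g * g').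
  rewrite !rmorphB !rmorphM !hornerD !hornerN !hornerM.
  have gy : (map_poly phi g).[y] != 0 by rewrite -z0.
  have gy' : (map_poly phi g').[y] != 0 by rewrite -z0.
  move=> EE; set A := (map_poly j f).[a] in EE *; set B := (map_poly j g).[a] in ga EE *.
  set A' := (map_poly j f').[a] in EE *; set B' := (map_poly j g').[a] in ga' EE *.
  have -> : A / B - A' / B' = (A * B' - A' * B) / (B * B') by field; rewrite ga ga'.
  by rewrite EE; field; rewrite gy gy'.
- move=> _ _ [f [g ->]] [f' [g' ->]]; rewrite !E.
  by have := E (f * f') (g * g'); rewrite !rmorphM !hornerM -!mulf_div.
Qed.
End HomOn.

(** * Approximable homomorphisms to the real numbers *)

Section MinPoly.
Variable F : fieldType.
Hypothesis char0 : forall n, n.+1%:R != 0 :> F.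
Implicit Types (K : set F) (P : {poly F}).

Definition minp K (a : F) P :=
  [/\ coefs_in K P, P != 0, root P a &
      forall f, coefs_in K f -> f != 0 -> root f a -> (size P <= size f)%N].

Lemma minp_exists K a :
  (forall f, coefs_in K f -> f != 0 -> ~~ root f a) \/ exists P, minp K a P.
Proof.
pose Q n := `[< exists f, [/\ coefs_in K f, f != 0, root f a & size f = n] >].
have [[f [Kf f0 fa]]|no] := pselect (exists f, [/\ coefs_in K f, f != 0 & root f a]).
  right; have exQ : exists n, Q n by exists (size f); apply/asboolP; exists f.
  have [n /asboolP[P [KP P0 Pa <-]] minn] := ex_minnP exQ.
  exists P; split=> // g Kg g0 ga; apply: minn; apply/asboolP; by exists g.
by left=> f Kf f0; apply/negP => fa; apply: no; exists f.
Qed.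

(** Characteristic 0 keeps the derivative nonzero; being of smaller degree, it cannot vanish at [a]
    by minimality. *)
Lemma minp_irreducible K a (k : fieldType) (j : {rmorphism k -> F}) (p : {poly k}) :
  (forall u, K (j u)) -> minp K a (map_poly j p) ->
  irreducible_poly p /\ ~~ root (map_poly j p^`()) a.
Proof.
move=> Kj [_ P0 Pa minP].
have p0 : p != 0 by rewrite -(map_poly_eq0 j).
have lt1 : (1 < size p)%N.
  rewrite ltnNge; apply: contraTN Pa => /size1_polyC; move: p`_0 => c pE.
  by rewrite pE map_polyC rootC /= fmorph_eq0; move: p0; rewrite pE polyC_eq0.
have min (f : {poly k}) : f != 0 -> root (map_poly j f) a -> (size p <= size f)%N.
  move=> f0 fa; have := minP (map_poly j f); rewrite !size_map_poly; apply=> //.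
    exact: coefs_in_map.
  by rewrite map_poly_eq0.
split; first split=> // q q1 qp.
  have [r pE] : exists r : {poly k}, p = r * q by have [r ->] := dvdpP _ _ qp; exists r.
  have q0 : q != 0 by apply: contra_neq p0 => q0; rewrite pE q0 mulr0.
  have r0 : r != 0 by apply: contra_neq p0 => r0; rewrite pE r0 mul0r.
  have sz : size p = (size r + size q).-1 by rewrite pE size_mul.
  move: Pa; rewrite pE rmorphM rootM => /orP[ra|qa].
    have := min _ r0 ra; rewrite sz.
    have : (0 < size q)%N by rewrite size_poly_gt0.
    have : (0 < size r)%N by rewrite size_poly_gt0.
    by move: q1; lia.
  rewrite -pE -dvdp_size_eqp // eqn_leq min // andbT.
  exact: dvdp_leq.
have lt_d : (size p^`() < size p)%N by apply: lt_size_deriv.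
apply: contraTN lt_d => pa'; rewrite -leqNgt min //.
apply: contraTneq (char0 (size p).-2) => d0; rewrite negbK.
have sE : (size p).-2.+1 = (size p).-1 by lia.
have /eqP : lead_coef p * (size p).-2.+1%:R = 0.
  by rewrite mulr_natr lead_coefE -{1}sE -coef_deriv d0 coef0.
by rewrite mulf_eq0 lead_coef_eq0 (negPf p0) /= -(fmorph_eq0 j) rmorph_nat.
Qed.
End MinPoly.

Section Tower.
Variables (R : realType) (F : fieldType) (emb : {rmorphism R -> F}).
Implicit Types (t : seq F) (rs : seq R).

Definition Qgen t rs : set F := gen (t ++ map emb rs).
Definition Rgen t : set F := [set x | exists rs, Qgen t rs x].

Lemma char0 n : n.+1%:R != 0 :> F.
Proof. by rewrite -(rmorph_nat emb) fmorph_eq0 pnatr_eq0. Qed.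

Lemma Qgen_sub t rs rs' : {subset rs <= rs'} -> Qgen t rs `<=` Qgen t rs'.
Proof.
move=> s; apply: gen_sub => x; rewrite !mem_cat => /orP[->//|/mapP[r rr ->]].
by rewrite map_f ?orbT // s.
Qed.

Lemma Qgen_tail a t rs : Qgen t rs `<=` Qgen (a :: t) rs.
Proof. by apply: gen_sub => x; rewrite /= inE => ->; rewrite orbT. Qed.

Lemma coefs_in_Rgen t P : coefs_in (Rgen t) P -> exists rs, coefs_in (Qgen t rs) P.
Proof.
move=> H; have [g gE] := choice H.
exists (flatten [seq g i | i <- iota 0 (size P)]) => i.
have [lt|le] := ltnP i (size P); last first.
  by rewrite nth_default //; exact: (subfield0 (gen_subfield _)).
apply: Qgen_sub (gE i) => r ri; apply/flattenP; exists (g i) => //.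
by apply: map_f; rewrite mem_iota.
Qed.

(** The reals [rs] already contain what the minimal polynomials of the tower need. These are minimal
    over R(t'), so adjoining further reals never factors them. *)
Fixpoint minp_over t rs : Prop :=
  if t is a :: t' then minp_over t' rs /\
    ((forall f, coefs_in (Rgen t') f -> f != 0 -> ~~ root f a) \/
     exists P, minp (Rgen t') a P /\ coefs_in (Qgen t' rs) P)
  else True.

Lemma minp_over_mono t rs rs' : {subset rs <= rs'} -> minp_over t rs -> minp_over t rs'.
Proof.
move=> s; elim: t => //= a t IHt [/IHt Ht H]; split=> //.
by case: H => [H|[P [mP cP]]]; [left|right; exists P; split=> // i; apply: Qgen_sub (cP i)].
Qed.

Lemma minp_over_exists t rs : exists rs', minp_over t (rs ++ rs').
Proof.
elim: t => [|a t [rs1 H1]]; first by exists [::].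
have [H|[P mP]] := minp_exists (Rgen t) a; first by exists rs1; split=> //; left.
have [rs2 H2] : exists rs, coefs_in (Qgen t rs) P by apply: coefs_in_Rgen; case: mP.
exists (rs1 ++ rs2); split.
  by apply: minp_over_mono H1 => r; rewrite !mem_cat => /orP[->|->]; rewrite ?orbT.
right; exists P; split=> // i; apply: Qgen_sub (H2 i) => r rr.
by rewrite !mem_cat rr !orbT.
Qed.

(** The homomorphisms on larger subfields need not extend [phi0]; they are only close to it on the
    finite set [W]. *)
Definition approximable t rs (phi0 : F -> R) :=
  hom_on (Qgen t rs) phi0 /\
  forall d (W : seq F) rs', 0 < d -> (forall w, w \in W -> Qgen t rs w) ->
    exists2 phi, hom_on (Qgen t (rs ++ rs')) phi & forall w, w \in W -> `|phi w - phi0 w| < d.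

(** A fraction is continuous in coefficients and point where [g] does not vanish; where it does,
    both fractions are 0 because zeros of [g] correspond. *)
Lemma near_quot (k : fieldType) (phi : {rmorphism k -> R}) (f g : {poly k}) y0 e : 0 < e ->
  exists2 d, 0 < d & forall (phi' : {rmorphism k -> R}) y,
    (forall c, c \in f ++ g -> `|phi' c - phi c| < d) -> `|y - y0| < d ->
    root (map_poly phi' g) y = root (map_poly phi g) y0 ->
    `|(map_poly phi' f).[y] / (map_poly phi' g).[y] -
      (map_poly phi f).[y0] / (map_poly phi g).[y0]| < e.
Proof.
move=> e0.
have coef_near (h : {poly k}) (phi' : {rmorphism k -> R}) d : 0 < d ->
    (forall c, c \in polyseq h -> `|phi' c - phi c| < d) ->
    forall i, `|(map_poly phi' h)`_i - (map_poly phi h)`_i| < d.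
  move=> d0 H i; rewrite !coef_map.
  have [lt|le] := ltnP i (size h); first by apply/H/mem_nth.
  by rewrite nth_default // !raddf0 addr0 normr0.
have [gy|gy] := boolP (root (map_poly phi g) y0).
  exists 1 => // phi' y _ _ /rootP->.
  by rewrite (rootP gy) !invr0 !mulr0 subrr normr0.
have [d1 d10 H1] := div_near (map_poly phi f).[y0] e0 gy.
have [d2 d20 H2] := poly_near (map_poly phi f) y0 d10.
have [d3 d30 H3] := poly_near (map_poly phi g) y0 d10.
exists (Num.min d2 d3); first by rewrite lt_min d20.
move=> phi' y Hc; rewrite lt_min => /andP[y2 y3] _.
apply: (H1 _ _ _ _).2.
  apply: H2 => //; first by rewrite !size_map_poly.
  apply: coef_near => // c cf; have := Hc c; rewrite mem_cat cf => /(_ isT).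
  by rewrite lt_min => /andP[].
apply: H3 => //; first by rewrite !size_map_poly.
apply: coef_near => // c cf; have := Hc c; rewrite mem_cat cf orbT => /(_ isT).
by rewrite lt_min => /andP[].
Qed.

Lemma near_quots (k : fieldType) (j : {rmorphism k -> F}) (phi : {rmorphism k -> R})
    a (W : seq F) y0 e : 0 < e -> (forall w, w \in W -> adj j a w) ->
  exists d (C : seq k), 0 < d /\ forall (phi' : {rmorphism k -> R}) y,
    (forall c, c \in C -> `|phi' c - phi c| < d) -> `|y - y0| < d ->
    (forall g : {poly k}, root (map_poly phi' g) y = root (map_poly phi g) y0) ->
    forall w, w \in W -> exists f g, w = (map_poly j f).[a] / (map_poly j g).[a] /\
    `|(map_poly phi' f).[y] / (map_poly phi' g).[y] -
      (map_poly phi f).[y0] / (map_poly phi g).[y0]| < e.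
Proof.
move=> e0; elim: W => [|w W IHW] HW; first by exists 1, [::].
have [|d1 [C1 [d10 H1]]] := IHW; first by move=> v vW; apply: HW; rewrite inE vW orbT.
have [f [g wE]] := HW w (mem_head _ _).
have [d2 d20 H2] := near_quot phi f g y0 e0.
exists (Num.min d1 d2), (C1 ++ (f ++ g)); split; first by rewrite lt_min d10.
move=> phi' y Hc; rewrite lt_min => /andP[y1 y2] comp v; rewrite inE => /orP[/eqP->|vW].
  exists f, g; split=> //; apply: H2 => // c cfg.
  by have := Hc c; rewrite mem_cat cfg orbT => /(_ isT); rewrite lt_min => /andP[].
apply: H1 => // c cC.
by have := Hc c; rewrite mem_cat cC => /(_ isT); rewrite lt_min => /andP[].
Qed.

(** There are countably many polynomials over [k]; zero and invalid codes are replaced by 1, which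
    has no roots. *)
Lemma avoid_alg (k : countFieldType) (phi : {rmorphism k -> R}) y0 e : 0 < e ->
  exists2 y, `|y - y0| < e & forall f : {poly k}, f != 0 -> ~~ root (map_poly phi f) y.
Proof.
move=> e0.
pose h n := if unpickle n is Some f then
  (if f == 0 :> {poly k} then 1 else map_poly phi f) else 1.
have h0 n : h n != 0.
  rewrite /h; case: unpickle => [f|]; last exact: oner_neq0.
  by have [_|f0] := eqVneq f 0; [exact: oner_neq0|rewrite map_poly_eq0].
have [|y /andP[y1 y2] Hy] := @avoid_roots R h (y0 - e) (y0 + e) h0; first by lra.
exists y => [|f f0]; first by rewrite ltr_norml; apply/andP; split; lra.
by have := Hy (pickle f); rewrite /h pickleK (negPf f0).
Qed.
End Tower.

(** * Extension of approximable homomorphisms along the tower *)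

Section Step.
Variables (R : realType) (F : fieldType) (emb : {rmorphism R -> F}).
Implicit Types (t : seq F) (rs : seq R).
Local Notation Qg := (Qgen emb).
Local Notation Rg := (Rgen emb).

Lemma compat_alg t a (k : fieldType) (j : {rmorphism k -> F}) (phi : {rmorphism k -> R}) y
    (p : {poly k}) :
  (forall u, Rg t (j u)) -> minp (Rg t) a (map_poly j p) -> root (map_poly phi p) y ->
  forall f, root (map_poly j f) a = root (map_poly phi f) y.
Proof.
move=> Kj mP py f; have [irr _] := minp_irreducible (char0 emb) Kj mP.
have pa : root (map_poly j p) a by case: mP.
by rewrite (irreducible_root irr pa) (irreducible_root irr py).
Qed.

Lemma compat_trans t a (k : fieldType) (j : {rmorphism k -> F}) (phi : {rmorphism k -> R}) y :
  (forall u, Rg t (j u)) -> (forall f, coefs_in (Rg t) f -> f != 0 -> ~~ root f a) ->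
  (forall f : {poly k}, f != 0 -> ~~ root (map_poly phi f) y) ->
  forall f, root (map_poly j f) a = root (map_poly phi f) y.
Proof.
move=> Kj tra tr f; have [->|f0] := eqVneq f 0; first by rewrite !rmorph0 !root0.
rewrite (negPf (tr _ f0)); apply/negP/negP/tra; first exact: coefs_in_map.
by rewrite map_poly_eq0.
Qed.

(** On a larger subfield, take a homomorphism close to [phi0] and move [y0] slightly: to a number
    transcendental over the image, or to the root, near the simple root [y0], of the transported
    minimal polynomial. *)
Lemma approximable_adj a t rs phi0 (k : fieldType) (j : {rmorphism k -> F})
    (phik : {rmorphism k -> R}) y0 :
  approximable emb t rs phi0 -> (forall x, Qg t rs x <-> exists u, j u = x) ->
  (forall u, phik u = phi0 (j u)) ->
  ((forall f, coefs_in (Rg t) f -> f != 0 -> ~~ root f a) /\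
   (forall f : {poly k}, f != 0 -> ~~ root (map_poly phik f) y0)) \/
  (exists p : {poly k}, [/\ minp (Rg t) a (map_poly j p), root (map_poly phik p) y0 &
     ~~ root (map_poly phik p^`()) y0]) ->
  exists phi1, approximable emb (a :: t) rs phi1 /\ forall f g : {poly k},
    phi1 ((map_poly j f).[a] / (map_poly j g).[a]) =
    (map_poly phik f).[y0] / (map_poly phik g).[y0].
Proof.
move=> [_ Hacc] lj phikE alt.
have Kj u : Rg t (j u) by exists rs; apply/lj; exists u.
have compat f : root (map_poly j f) a = root (map_poly phik f) y0.
  case: alt => [[tra tr]|[p [mP py _]]]; first exact: (compat_trans Kj tra tr).
  exact: (compat_alg Kj mP py).
have [phi1 Hphi1 phi1E] := hom_on_adj compat.
have GE : Qg (a :: t) rs = adj j a by apply: gen_cons.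
exists phi1; split=> //; split; first by rewrite GE.
move=> d W rs' d0 HW.
have [e [C [e0 HC]]] := near_quots (j := j) (a := a) phik y0 d0
  (fun w wW => eq_rect _ (fun A : set F => A w) (HW w wW) _ GE).
have [k2 [j2 lj2]] := gen_countable ((emb \o ratr)%FUN : {rmorphism rat -> F})
  (t ++ map emb (rs ++ rs')).
have [u|iota iotaE] := @factor_rmorphism k k2 F j j2.
  apply/lj2; apply: (@Qgen_sub _ _ emb t rs); first by move=> r rr; rewrite mem_cat rr.
  by apply/lj; exists u.
have GE2 : Qg (a :: t) (rs ++ rs') = adj j2 a by apply: gen_cons.
have Kj2 u : Rg t (j2 u) by exists (rs ++ rs'); apply/lj2; exists u.
have map_iota (f : {poly k}) : map_poly j2 (map_poly iota f) = map_poly j f.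
  by rewrite -map_poly_comp; apply: eq_map_poly => u /=; rewrite iotaE.
(* Both cases end alike once the same polynomials over [k2] vanish at [a] and at [y]. *)
have finish (phi : F -> R) (phi2 : {rmorphism k2 -> R}) y :
    (forall u, phi2 u = phi (j2 u)) ->
    (forall c, c \in C -> `|phi (j c) - phi0 (j c)| < e) -> `|y - y0| < e ->
    (forall f, root (map_poly j2 f) a = root (map_poly phi2 f) y) ->
    exists2 phi3, hom_on (Qg (a :: t) (rs ++ rs')) phi3 &
      forall w, w \in W -> `|phi3 w - phi1 w| < d.
  move=> phi2E Cphi yy0 compat2.
  have [phi3 Hphi3 phi3E] := hom_on_adj compat2.
  exists phi3; first by rewrite GE2.
  pose phi' : {rmorphism k -> R} := (phi2 \o iota)%FUN.
  have map_phi' (f : {poly k}) : map_poly phi' f = map_poly phi2 (map_poly iota f).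
    by rewrite -map_poly_comp.
  move=> w wW; have [||f [g [-> near]]] := HC phi' y _ yy0 _ w wW.
  - by move=> c cC; rewrite /= phi2E iotaE phikE; apply: Cphi.
  - by move=> g; rewrite map_phi' -compat2 map_iota compat.
  by rewrite phi1E -!map_iota phi3E -!map_phi'.
have GjC (C' : seq k) w : w \in map j C' -> Qg t rs w.
  by move=> /mapP[c _ ->]; apply/lj; exists c.
case: alt => [[tra tr]|[p [mP py p'y]]].
  have [phi Hphi near] := Hacc e (map j C) rs' e0 (@GjC C).
  have [|phi2 phi2E] := @hom_on_rmorph F R _ phi _ j2 _ Hphi; first by move=> u; apply/lj2; exists u.
  have [y yy0 try] := avoid_alg phi2 y0 e0.
  apply: (finish phi phi2 y) => //.
    by move=> c cC; apply: near; rewrite map_f.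
  exact: (compat_trans Kj2 tra try).
have py' : ~~ root (map_poly phik p)^`() y0 by rewrite deriv_map.
have [e' e'0 He'] := near_root e0 py py'.
have m0 : 0 < Num.min e e' by rewrite lt_min e0.
have [phi Hphi near] := Hacc _ (map j (C ++ p)) rs' m0 (@GjC _).
have [|phi2 phi2E] := @hom_on_rmorph F R _ phi _ j2 _ Hphi; first by move=> u; apply/lj2; exists u.
have [||y yy0 fy] := He' (map_poly phi2 (map_poly iota p)).
- by rewrite !size_map_poly.
- move=> i; rewrite !coef_map /= phi2E iotaE phikE.
  have [lt|le] := ltnP i (size p).
    have := near (j p`_i); rewrite map_f ?mem_cat ?mem_nth ?orbT // => /(_ isT).
    by rewrite lt_min => /andP[].
  by rewrite nth_default // -phikE -iotaE -phi2E !rmorph0 subrr normr0.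
apply: (finish phi phi2 y) => //.
  move=> c cC; have := near (j c); rewrite map_f ?mem_cat ?cC // => /(_ isT).
  by rewrite lt_min => /andP[].
(* [p] is still minimal over the larger field [k2], because its minimality is over R(t). *)
by apply: (compat_alg Kj2 _ fy); rewrite map_iota.
Qed.

(** By [sign_transfer], signs of fractions in [a] reduce to signs of finitely many elements of the
    field below; this is why [W] varies in the induction on the tower. *)
Lemma approximable_exists t rs (O : rcfType) (psi : F -> O) (W : seq F) :
  minp_over emb t rs -> hom_on (Qg t rs) psi ->
  (forall r, 0 <= r -> Qg [::] rs (emb r) -> 0 <= psi (emb r)) ->
  (forall w, w \in W -> Qg t rs w) ->
  exists phi0, approximable emb t rs phi0 /\ forall w, w \in W -> sgz (psi w) = sgz (phi0 w).
Proof.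
move=> gd Hpsi psi0; elim: t gd Hpsi W => [|a t IHt] gd Hpsi W HW.
  (* With no generators the field consists of reals, and the inverse of [emb] serves as homomorphism
     at every level; [psi0] makes [psi] agree with it in sign. *)
  have base rs1 : forall x, Qg [::] rs1 x -> exists r, emb r = x.
    apply: gen_min => [|x /mapP[r _ ->]]; last by exists r.
    split=> [|_ _ [r <-] [s <-]|_ _ [r <-] [s <-]].
    - by exists 1; rewrite rmorph1.
    - by exists (r - s); rewrite rmorphB.
    - by exists (r / s); rewrite fmorph_div.
  have [phi0 Hphi0 phi0E] := @rmorph_hom_on F R [set x | exists r, emb r = x] R emb
    (idfun : {rmorphism R -> R}) (fun x => id).
  exists phi0; split.
    split; first by apply: hom_on_sub Hphi0 => x /base.
    move=> d W' rs' d0 HW'; exists phi0; first by apply: hom_on_sub Hphi0 => x /base.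
    by move=> w _; rewrite subrr normr0.
  have HG := gen_subfield ([::] ++ map emb rs).
  move=> w wW; have [r rE] := base _ _ (HW w wW); rewrite -rE phi0E /=.
  have Gr : Qg [::] rs (emb r) by rewrite rE; apply: HW.
  have [psi1 psiB _] := Hpsi.
  have psi_0 : psi 0 = 0 by rewrite -(subrr 1) psiB ?subrr //; apply: (subfield1 HG).
  have psiN : psi (emb (- r)) = - psi (emb r).
    by rewrite rmorphN -sub0r psiB ?psi_0 ?sub0r //; apply: (subfield0 HG).
  have [k [j lj]] := subfield_type HG.
  have [|psik psikE] := @hom_on_rmorph F O _ psi k j _ Hpsi; first by move=> u; apply/lj; exists u.
  have psi_eq0 x : Qg [::] rs x -> (psi x == 0) = (x == 0).
    by move=> /lj[u <-]; rewrite -psikE !fmorph_eq0.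
  case: (ltrgt0P r) => [r0|r0|r0].
  - rewrite (gtr0_sgz r0) gtr0_sgz // lt_neqAle eq_sym psi_eq0 // fmorph_eq0 gt_eqF //=.
    by apply: psi0 => //; apply: ltW.
  - rewrite (ltr0_sgz r0) ltr0_sgz // lt_neqAle psi_eq0 // fmorph_eq0 lt_eqF //=.
    rewrite -oppr_ge0 -psiN; apply: psi0; first by rewrite oppr_ge0 ltW.
    by rewrite rmorphN; apply: (subfieldN HG).
  - by rewrite r0 rmorph0 psi_0 !sgz0.
case: gd => gd alt.
have [k [j lj]] := gen_countable ((emb \o ratr)%FUN : {rmorphism rat -> F})
  (t ++ map emb rs).
have GE : Qg (a :: t) rs = adj j a by apply: gen_cons.
have Hpsi_t : hom_on (Qg t rs) psi by apply: hom_on_sub Hpsi; apply: Qgen_tail.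
have [|psik psikE] := @hom_on_rmorph F O _ psi k j _ Hpsi_t; first by move=> u; apply/lj; exists u.
have Kj u : Rg t (j u) by exists rs; apply/lj; exists u.
have Ga : Qg (a :: t) rs a by apply: mem_gen; rewrite mem_head.
have Gj u : Qg (a :: t) rs (j u) by apply: Qgen_tail; apply/lj; exists u.
have HGa : is_subfield (Qg (a :: t) rs) by apply: gen_subfield.
have [k' [j' lj']] := subfield_type HGa.
have [|psi' psi'E] := @hom_on_rmorph F O _ psi k' j' _ Hpsi; first by move=> u; apply/lj'; exists u.
have [a' a'E] : exists a', j' a' = a by apply/lj'.
have [u|iota iotaE] := @factor_rmorphism k k' F j j'; first by apply/lj'.
have psi_poly (f : {poly k}) : psi (map_poly j f).[a] = (map_poly psik f).[psi a].
  have -> : (map_poly j f).[a] = j' (map_poly iota f).[a'].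
    rewrite -horner_map a'E -map_poly_comp; congr (_.[_]).
    by apply: eq_map_poly => u /=; rewrite iotaE.
  rewrite -psi'E -horner_map -map_poly_comp psi'E a'E; congr (_.[_]).
  by apply: eq_map_poly => u /=; rewrite psi'E iotaE psikE.
have psi_frac (f g : {poly k}) : psi ((map_poly j f).[a] / (map_poly j g).[a]) =
    (map_poly psik f).[psi a] / (map_poly psik g).[psi a].
  rewrite -!psi_poly.
  have in' (h : {poly k}) : exists u, j' u = (map_poly j h).[a].
    by apply/lj'; rewrite GE; exists h, 1; rewrite rmorph1 hornerC divr1.
  by have [u <-] := in' f; have [v <-] := in' g; rewrite -fmorph_div -!psi'E fmorph_div.
have [fs fsE] : exists fs : seq ({poly k} * {poly k}), forall w, w \in W ->
    exists2 fg, fg \in fs & w = (map_poly j fg.1).[a] / (map_poly j fg.2).[a].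
  elim: W HW => [|w W IHW] HW; first by exists [::].
  have [|fs Hfs] := IHW; first by move=> v vW; apply: HW; rewrite inE vW orbT.
  have : Qg (a :: t) rs w by apply: HW; rewrite mem_head.
  rewrite GE => -[f [g wE]]; exists ((f, g) :: fs) => v.
  rewrite inE => /orP[/eqP->|/Hfs[fg fgs vE]]; first by exists (f, g); rewrite ?mem_head.
  by exists fg => //; rewrite inE fgs orbT.
pose ps := flatten [seq [:: fg.1; fg.2] | fg <- fs].
have sgz_div (L : rcfType) (x y : L) : sgz (x / y) = sgz x * sgz y.
  by rewrite sgzM; congr (_ * _); case: (ltrgt0P y) => [y0|y0|->]; rewrite ?invr0 //;
     [rewrite !gtr0_sgz ?invr_gt0|rewrite !ltr0_sgz ?invr_lt0].
suff [Wk HWk] : exists Wk : seq k, forall phi0 (phik : {rmorphism k -> R}),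
    (forall u, phik u = phi0 (j u)) -> (forall w, w \in map j Wk -> sgz (psi w) = sgz (phi0 w)) ->
    exists y0, (forall f, f \in ps -> sgz (map_poly psik f).[psi a] = sgz (map_poly phik f).[y0]) /\
    (((forall f, coefs_in (Rg t) f -> f != 0 -> ~~ root f a) /\
   (forall f : {poly k}, f != 0 -> ~~ root (map_poly phik f) y0)) \/
  (exists p : {poly k}, [/\ minp (Rg t) a (map_poly j p), root (map_poly phik p) y0 &
     ~~ root (map_poly phik p^`()) y0])).
  have [|phi0 [Hacc sgn]] := IHt gd Hpsi_t (map j Wk).
    by move=> w /mapP[u _ ->]; apply/lj; exists u.
  have [|phik phikE] := @hom_on_rmorph F R _ phi0 k j _ Hacc.1; first by move=> u; apply/lj; exists u.
  have [y0 [sgy alt']] := HWk phi0 phik phikE sgn.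
  have [phi1 [acc1 phi1E]] := approximable_adj Hacc lj phikE alt'.
  exists phi1; split=> // w /fsE[fg fgs ->].
  have [ps1 ps2] : fg.1 \in ps /\ fg.2 \in ps.
    by split; apply/flattenP; exists [:: fg.1; fg.2]; rewrite ?inE ?eqxx ?orbT //;
       apply/mapP; exists fg.
  by rewrite psi_frac phi1E !sgz_div !sgy.
have sgzE (phi0 : F -> R) (phik : {rmorphism k -> R}) (Wk : seq k) :
    (forall u, phik u = phi0 (j u)) ->
    (forall w, w \in map j Wk -> sgz (psi w) = sgz (phi0 w)) ->
    forall w, w \in Wk -> sgz (psik w) = sgz (phik w).
  by move=> phikE H w wW; rewrite psikE phikE; apply: H; apply: map_f.
case: alt => [tra|[P [mP cP]]].
  have [Wk HWk] := sign_transfer ps psik (psi a).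
  exists Wk => phi0 phik phikE /(sgzE _ _ _ phikE)/HWk[y' sgy'].
  have nz (f : {poly k}) : f \in ps -> f != 0 -> (map_poly phik f).[y'] != 0.
    move=> fps f0; rewrite -sgz_eq0 -sgy' // sgz_eq0 -psi_poly.
    have : ~~ root (map_poly j f) a by apply: tra; rewrite ?map_poly_eq0 //; exact: coefs_in_map.
    have [u uE] : exists u, j' u = (map_poly j f).[a].
      by apply/lj'; rewrite GE; exists f, 1; rewrite rmorph1 hornerC divr1.
    by rewrite /root -uE -psi'E !fmorph_eq0.
  (* For transcendental [a], no nonzero polynomial in [ps] vanishes at [y'], so the signs persist
     nearby and [y'] can be moved to a transcendental number. *)
  have [e [e0 He]] : exists e, 0 < e /\ forall f, f \in ps -> f != 0 ->
      forall y, `|y - y'| < e -> sgz (map_poly phik f).[y] = sgz (map_poly phik f).[y'].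
    elim: (ps) nz => [|f s IHs] nz; first by exists 1.
    have [|e [e0 He]] := IHs; first by move=> g gs; apply: nz; rewrite inE gs orbT.
    have [f0|f0] := eqVneq f 0.
      exists e; split=> // g; rewrite inE => /orP[/eqP->|]; first by rewrite f0 eqxx.
      exact: He.
    have fy : 0 < `|(map_poly phik f).[y']| by rewrite normr_gt0 nz // mem_head.
    have [d d0 Hd] := poly_cont y' (map_poly phik f) fy.
    exists (Num.min e d); split; first by rewrite lt_min e0.
    move=> g; rewrite inE => /orP[/eqP-> _|gs g0] y; rewrite lt_min => /andP[ye yd]; last exact: He.
    have := Hd y yd; case: (ltrgt0P (map_poly phik f).[y']) => [q0|q0|q0].
    - by rewrite ltr_norml => /andP[q1 _]; rewrite !gtr0_sgz //; lra.
    - by rewrite ltr_norml => /andP[_ q1]; rewrite !ltr0_sgz //; lra.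
    - by rewrite normr_lt0.
  have [y0 yy0 try] := avoid_alg phik y' e0.
  exists y0; split; last by left.
  move=> f fps; rewrite sgy' //; have [->|f0] := eqVneq f 0; first by rewrite !rmorph0 !horner0.
  by rewrite (He f).
have [p pE] := coefs_in_lift lj cP; rewrite {}pE in mP.
(* Including [p] and its derivative forces [y'] to be a simple root of [p]. *)
have [Wk HWk] := sign_transfer (p :: p^`() :: ps) psik (psi a).
exists Wk => phi0 phik phikE /(sgzE _ _ _ phikE)/HWk[y' sgy'].
exists y'; split; first by move=> f fps; apply: sgy'; rewrite !inE fps !orbT.
right; exists p; split=> //.
  rewrite /root -sgz_eq0 -sgy' ?mem_head // sgz_eq0 -psi_poly.
  have : root (map_poly j p) a by case: mP.
  rewrite /root => /eqP->.
  by have := psi'E 0; rewrite !rmorph0 => <-.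
rewrite /root -sgz_eq0 -sgy' ?inE ?eqxx ?orbT // sgz_eq0 -psi_poly.
have [_] := minp_irreducible (char0 emb) Kj mP.
have [u uE] : exists u, j' u = (map_poly j p^`()).[a].
  by apply/lj'; rewrite GE; exists p^`(), 1; rewrite rmorph1 hornerC divr1.
by rewrite /root -uE -psi'E !fmorph_eq0.
Qed.
End Step.

(** * Real places and orderings *)

Section OrderedPlace.
Variables (R : realType) (D : realFieldType) (i : {rmorphism R -> D}).

(** Nonnegative reals are squares, so any embedding into an ordered field preserves the order. *)
Lemma emb_ge0 r : 0 <= r -> 0 <= i r.
Proof. by move=> r0; rewrite -(sqr_sqrtr r0) rmorphXn sqr_ge0. Qed.

Lemma emb_le r s : r <= s -> i r <= i s.
Proof. by move=> rs; rewrite -subr_ge0 -rmorphB emb_ge0 // subr_ge0. Qed.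

Lemma emb_lt r s : r < s -> i r < i s.
Proof.
by move=> rs; rewrite lt_neqAle emb_le ?ltW // andbT (inj_eq (fmorph_inj i)) lt_eqF.
Qed.

Lemma emb_gt0 r : 0 < r -> 0 < i r.
Proof. by move/emb_lt; rewrite rmorph0. Qed.

Lemma emb_half e : i e = i (e / 2) + i (e / 2).
Proof. by rewrite -rmorphD; congr (i _); field. Qed.

Lemma emb_norm r : `|i r| = i `|r|.
Proof.
case: (lerP 0 r) => r0; first by rewrite !ger0_norm // emb_ge0.
by rewrite !ltr0_norm ?rmorphN // -(rmorph0 i) emb_lt.
Qed.

(** The standard part, as a relation because infinite [u] have none. *)
Definition std (u : D) (r : R) := forall e, 0 < e -> `|u - i r| < i e.

Lemma std_emb r : std (i r) r.
Proof. by move=> e e0; rewrite subrr normr0 emb_gt0. Qed.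

Lemma std_uniq u r s : std u r -> std u s -> r = s.
Proof.
move=> ur us; apply/eqP; rewrite -subr_eq0 -normr_eq0; apply/negPn/negP => rs.
have d0 : 0 < `|r - s| by rewrite lt_neqAle eq_sym rs normr_ge0.
have d2 : 0 < `|r - s| / 2 by rewrite divr_gt0.
have : `|i r - i s| < i `|r - s|.
  have -> : i r - i s = (u - i s) - (u - i r) by ring.
  rewrite (le_lt_trans (ler_normB _ _)) // (emb_half `|r - s|).
  by rewrite ltrD // ?us // ur.
by rewrite -rmorphB emb_norm ltxx.
Qed.

Lemma stdD u v r s : std u r -> std v s -> std (u + v) (r + s).
Proof.
move=> ur vs e e0; have e2 : 0 < e / 2 by rewrite divr_gt0.
rewrite rmorphD (_ : _ - _ = (u - i r) + (v - i s)); last by ring.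
rewrite (le_lt_trans (ler_normD _ _)) // (emb_half e).
by rewrite ltrD ?ur ?vs.
Qed.

Lemma stdM u v r s : std u r -> std v s -> std (u * v) (r * s).
Proof.
move=> ur vs e e0.
(* The error splits into [(u - r)(v - s)], below [d] since [|v - s|] is at most 1, and
   [r (v - s) + s (u - r)], at most [d (|r| + |s|)]; together below [d M]. *)
pose M := `|r| + `|s| + 1; have M0 : 0 < M by rewrite ltr_wpDl // addr_ge0.
pose d := Num.min 1 (e / M).
have d0 : 0 < d by rewrite lt_min ltr01 divr_gt0.
have d1 : d <= 1 by rewrite ge_min lexx.
have dM : d * M <= e by rewrite -ler_pdivlMr // ge_min lexx orbT.
rewrite rmorphM (_ : _ - _ = (u - i r) * (v - i s) + (i r * (v - i s) + i s * (u - i r))); last by ring.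
have B : `|(u - i r) * (v - i s)| + (`|i r * (v - i s)| + `|i s * (u - i r)|) < i (d * M).
  rewrite !normrM !emb_norm /M.
  have -> : i (d * (`|r| + `|s| + 1)) = i d * 1 + (i `|r| * i d + i `|s| * i d).
    by rewrite !(rmorphM, rmorphD, rmorph1); ring.
  have h1 := ur d d0; have h2 := vs d d0.
  have h3 : i d <= 1 by rewrite -(rmorph1 i) emb_le.
  have nr : 0 <= i `|r| by apply: emb_ge0.
  have ns : 0 <= i `|s| by apply: emb_ge0.
  apply: ltr_leD.
    apply: (@le_lt_trans _ _ `|u - i r|); last by rewrite mulr1.
    by rewrite ler_piMr // ltW // (lt_le_trans h2).
  by apply: lerD; [apply: ler_wpM2l nr _ _ _|apply: ler_wpM2l ns _ _ _]; apply: ltW.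
apply: lt_le_trans (emb_le dM); apply: le_lt_trans B.
by rewrite (le_trans (ler_normD _ _)) // lerD2l ler_normD.
Qed.

Lemma std_bounded u C : `|u| <= i C -> exists r, std u r.
Proof.
move=> uC; pose E := [set r | i r <= u].
have [u1 u2] : - i C <= u /\ u <= i C by apply/andP; rewrite -ler_norml.
have Eub x : E x -> x <= C.
  move=> Ex; rewrite leNgt; apply/negP => /emb_lt; rewrite ltNge.
  by rewrite (le_trans Ex).
have E0 : E !=set0 by exists (- C); rewrite /E /= rmorphN.
exists (sup E) => e e0.
have e2 : 0 < e / 2 by rewrite divr_gt0.
have h1 : u < i (sup E + e / 2).
  rewrite ltNge; apply/negP => /(ub_le_sup (ex_intro _ C Eub)).
  by rewrite gerDl leNgt e2.
have [x Ex xE] := sup_adherent e2 (conj E0 (ex_intro _ C Eub)).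
have h2 : i (sup E - e / 2) < u by rewrite (lt_le_trans (emb_lt xE)).
have h3 : i (e / 2) < i e by apply: emb_lt; lra.
move: h1 h2; rewrite rmorphD rmorphB => h1 h2.
by rewrite ltr_norml; apply/andP; split; lra.
Qed.
End OrderedPlace.

(** Elements bounded by reals go to their standard parts, all others to infinity; the inverse of an
    unbounded element is infinitesimal. *)
Lemma cone_place (R : realType) (F : fieldType) (emb : {rmorphism R -> F}) (P : set F) :
  cone P -> exists z : F -> option R,
  [/\ Rplace (@id F) z, forall r, z (emb r) = Some r,
      forall u C, P (emb C - u) -> P (emb C + u) -> exists r, z u = Some r &
      forall u r, P u -> z u = Some r -> 0 <= r].
Proof.
move=> HP; have [D [e [eP esurj]]] := ordered_field HP.
have [r|i iE] := @factor_rmorphism R D F emb e; first exact: esurj.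
pose st x r := exists2 u, e u = x & std i u r.
have st_uniq x r s : st x r -> st x s -> r = s.
  move=> [u <- ur] [v /fmorph_inj -> vs]; exact: std_uniq ur vs.
have H (x : F) : exists z : option R, forall r, st x r <-> z = Some r.
  have [[r xr]|no] := pselect (exists r, st x r).
    by exists (Some r) => s; split=> [/(st_uniq _ _ _ xr)->|[<-]].
  by exists None => s; split=> // xs; case: no; exists s.
have [z zP] := choice H.
have zemb r : z (emb r) = Some r.
  by apply/zP; exists (i r) => //; exact: std_emb.
have bounded u C : `|u| <= i C -> exists r, z (e u) = Some r.
  by move=> /std_bounded[r ur]; exists r; apply/zP; exists u.
exists z; split=> //.
- split; first by move=> u ->; rewrite -(rmorph1 emb).
  split.
    move=> u v w a b /zP[u' <- ua] /zP[v' <- vb] ->; apply/zP.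
    by exists (u' + v'); [rewrite rmorphD|apply: stdD].
  split.
    move=> u v w a b /zP[u' <- ua] /zP[v' <- vb] ->; apply/zP.
    by exists (u' * v'); [rewrite rmorphM|apply: stdM].
  move=> u v uv; have [u' u'E] := esurj u; have [v' v'E] := esurj v.
  have uv' : u' * v' = 1 by apply: (fmorph_inj e); rewrite rmorphM u'E v'E rmorph1.
  split.
    move=> zu; apply/zP; exists v' => // d d0; rewrite rmorph0 subr0 ltNge.
    apply/negP => dv; have [|r] := bounded u' d^-1; last by rewrite u'E zu.
    have v0 : v' != 0.
      by apply/eqP => v0; move/eqP: uv'; rewrite v0 mulr0 eq_sym oner_eq0.
    have -> : u' = v'^-1 by apply: (mulIf v0); rewrite uv' mulVf.
    by rewrite normfV fmorphV lef_pV2 ?posrE ?normr_gt0 ?emb_gt0.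
  move=> /zP[v'' v''E v0]; have {v'' v''E v0} v0 : std i v' 0.
    by move: v0; rewrite (_ : v'' = v') //; apply: (fmorph_inj e); rewrite v'E.
  case zu : (z u) => [r|//]; move/zP: zu => [u'' u''E ur].
  have {u'' u''E ur} ur : std i u' r.
    by move: ur; rewrite (_ : u'' = u') //; apply: (fmorph_inj e); rewrite u'E.
  have s1 : std i 1 1 by rewrite -[X in std i X 1](rmorph1 i); exact: std_emb.
  have := stdM ur v0; rewrite uv' mulr0 => /std_uniq/(_ s1)/eqP.
  by rewrite eq_sym oner_eq0.
- move=> u C; have [u' <-] := esurj u; rewrite -iE -rmorphB -rmorphD => /eP h1 /eP h2.
  by apply: (bounded u' C); rewrite ler_norml; apply/andP; split; lra.
- move=> u r Pu /zP[u' u'E ur]; have u0 : 0 <= u' by apply/eP; rewrite u'E.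
  rewrite leNgt; apply/negP => r0; have := ur (- r); rewrite oppr_gt0 rmorphN => /(_ r0).
  by have := ler_norm (u' - i r); lra.
Qed.

Section PlaceFacts.
Variables (R : realType) (F : fieldType) (z : F -> option R).
Hypothesis Hz : Rplace (@id F) z.

Lemma place1 : z 1 = Some 1. Proof. by apply: Hz.1. Qed.
Lemma placeD u v a b : z u = Some a -> z v = Some b -> z (u + v) = Some (a + b).
Proof. by move=> ua vb; apply: Hz.2.1 ua vb _. Qed.
Lemma placeM u v a b : z u = Some a -> z v = Some b -> z (u * v) = Some (a * b).
Proof. by move=> ua vb; apply: Hz.2.2.1 ua vb _. Qed.
Lemma placeV_None u : u != 0 -> (z u = None <-> z u^-1 = Some 0).
Proof. by move=> u0; apply: Hz.2.2.2; apply: mulfV. Qed.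

(** As [-1] is its own inverse, an infinite value there would also have to be 0; additivity gives
    the rest. *)
Lemma placeN1_0 : z (-1) = Some (-1) /\ z 0 = Some 0.
Proof.
have m1 : (-1) ^-1 = -1 :> F by rewrite invrN invr1.
have := @placeV_None (-1); rewrite m1 oppr_eq0 oner_neq0 => /(_ isT).
case E : (z (-1)) => [c|] H; last by have := H.1 erefl.
have z0 := placeD place1 E; rewrite subrr in z0.
have := placeM z0 z0; rewrite mul0r z0 => -[tt].
have := placeD place1 z0; rewrite addr0 place1 => -[t0].
by split; congr Some; lra.
Qed.
Lemma place0 : z 0 = Some 0. Proof. by case: placeN1_0. Qed.
Lemma placeN u a : z u = Some a -> z (- u) = Some (- a).
Proof. by move=> ua; rewrite -(mulN1r u) -(mulN1r a); apply: placeM => //; case: placeN1_0. Qed.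
Lemma placeV u a : z u = Some a -> a != 0 -> z u^-1 = Some a^-1.
Proof.
move=> ua a0; have u0 : u != 0.
  by apply: contra_neq a0 => u0; move: ua; rewrite u0 place0 => -[].
case E : (z u^-1) => [b|]; last first.
  have := @placeV_None u^-1; rewrite invr_eq0 u0 invrK => /(_ isT)[/(_ E)].
  by rewrite ua => -[] a0'; rewrite a0' eqxx in a0.
have := placeM ua E; rewrite mulfV // place1 => -[ab].
by congr Some; apply: (mulfI a0); rewrite -ab mulfV.
Qed.
Lemma place_total u v : u != 0 ->
  (exists a, z (v / u) = Some a) \/ (v != 0 /\ z (u / v) = Some 0).
Proof.
move=> u0; case E : (z (v / u)) => [a|]; first by left; exists a.
right; have [v0|v0] := eqVneq v 0; first by move: E; rewrite v0 mul0r place0.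
split=> //; move: E; rewrite placeV_None ?invf_div //.
by rewrite mulf_eq0 invr_eq0 negb_or v0.
Qed.

(** In a sum of squares weighted by elements of positive value no leading terms cancel: if nonzero,
    the sum is a square times an element of positive value. Hence it is never -1. *)
Lemma place_cone : exists P, cone P /\ forall b r, z b = Some r -> 0 < r -> P b.
Proof.
pose V : set F := [set v | exists2 r, z v = Some r & 0 < r].
have key x : wsos V x -> x = 0 \/ exists w r, [/\ w != 0, z (x / w ^+ 2) = Some r & 0 < r].
  elim=> [|v f y [a va a0] _ IHy]; first by left.
  have [->|f0] := eqVneq f 0; first by rewrite expr0n mulr0 add0r.
  right; case: IHy => [->|[w [r [w0 yr r0]]]].
    by exists f, a; rewrite addr0 mulfK // expf_neq0.
  case: (place_total f w0) => [[c fc]|[_ fw]].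
    exists w, (a * (c * c) + r); split=> //; last first.
      by rewrite ltr_wpDl // mulr_ge0 ?(ltW a0) // -expr2 sqr_ge0.
    have -> : (v * f ^+ 2 + y) / w ^+ 2 = v * (f / w * (f / w)) + y / w ^+ 2 by field.
    by apply: placeD => //; apply: placeM => //; apply: placeM.
  exists f, (a + r * (0 * 0)); split=> //; last by rewrite !mulr0 addr0.
  have -> : (v * f ^+ 2 + y) / f ^+ 2 = v + y / w ^+ 2 * (w / f * (w / f)).
    by field; rewrite f0 w0.
  by apply: placeD => //; apply: placeM => //; apply: placeM.
have [|P [HP VP]] := @cone_extend F (wsos V).
  apply: wsos_precone.
  - by exists 1; rewrite ?place1.
  - move=> u v [a ua a0] [b vb b0]; exists (a * b); [exact: placeM|exact: mulr_gt0].
  move=> /key[/eqP|[w [r [w0 wr r0]]]]; first by rewrite oppr_eq0 oner_eq0.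
  have := @placeN _ _ wr; rewrite mulN1r opprK => w2.
  case E : (z w^-1) => [c|].
    have := placeM E E; rewrite -expr2 exprVn w2 => -[h].
    by have := sqr_ge0 c; rewrite expr2 -h; lra.
  have wz := (placeV_None (invr_neq0 w0)).1 E; rewrite invrK in wz.
  have := placeM (placeM wz wz) w2; rewrite -expr2 mulfV ?expf_neq0 // place1 !mul0r => -[].
  by move=> /eqP; rewrite oner_eq0.
by exists P; split=> // b r br r0; apply/VP/wsos_in; exists r.
Qed.
End PlaceFacts.

(** * Places finite on a prescribed finite set *)

Section FinitePlace.
Variables (R : realType) (F : fieldType) (emb : {rmorphism R -> F}) (s : seq F).
Local Notation Qg := (Qgen emb).

Lemma Qgen_directed rs rs' : [/\ Qg s rs `<=` Qg s (rs ++ rs') & Qg s rs' `<=` Qg s (rs ++ rs')].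
Proof. by split; apply: Qgen_sub => r; rewrite mem_cat => ->; rewrite ?orbT. Qed.

Lemma gen_field_Qgen : gen_field emb [set x | x \in s] `<=` [set x | exists rs, Qg s rs x].
Proof.
move=> x; apply.
  split; first by move=> r; exists [:: r]; apply: mem_gen; rewrite mem_cat mem_head orbT.
  split=> [y z [rs ry] [rs' rz]|y [rs ry]]; last by exists rs; exact: (subfieldV (gen_subfield _)).
  have [s1 s2] := Qgen_directed rs rs'; have HG := gen_subfield (s ++ map emb (rs ++ rs')).
  split; exists (rs ++ rs'); [apply: (subfieldB HG)|apply: (subfieldM HG)];
    by [apply: s1|apply: s2].
by move=> y ys; exists [::]; apply: mem_gen; rewrite mem_cat ys.
Qed.

Hypothesis fg : forall x, exists rs, Qg s rs x.

(** The place attached to [P] itself may be infinite on [S]. Homomorphisms near [phi0] are bounded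
    on [S], and the bounds pass to [T] and to any ordering above it. *)
Lemma finite_place (P : set F) (S : seq F) : cone P ->
  exists z, [/\ Rplace (@id F) z, forall r, z (emb r) = Some r &
    forall x, x \in S -> exists r, z x = Some r /\ (P x -> 0 <= r)].
Proof.
move=> [HP totP].
have [rs0 S0] : exists rs, forall x, x \in S -> Qg s rs x.
  elim: S => [|x S' [rs IH]]; first by exists [::].
  have [rs' xrs'] := fg x; have [s1 s2] := Qgen_directed rs rs'.
  by exists (rs ++ rs') => y; rewrite inE => /orP[/eqP->|/IH]; [exact: s2|exact: s1].
have [rs1 gd] := minp_over_exists emb s rs0.
set rs := rs0 ++ rs1 in gd; have SG x : x \in S -> Qg s rs x.
  by move=> /S0; apply: (Qgen_directed rs0 rs1).1.
have [k [j lj]] := gen_countable ((emb \o ratr)%FUN : {rmorphism rat -> F}) (s ++ map emb rs).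
have [|O [i iP]] := @real_closure k [set u | P (j u)].
  split; last by move=> u /=; rewrite rmorphN; apply: totP.
  split=> [u|u v|u v|] /=.
  - by rewrite rmorphXn; exact: (precone_sqr HP).
  - by rewrite rmorphD; exact: (preconeD HP).
  - by rewrite rmorphM; exact: (preconeM HP).
  - by rewrite rmorphN1; exact: (preconeN1 HP).
have [psi Hpsi psiE] := @rmorph_hom_on F O (Qg s rs) k j i (fun x => (lj x).1).
have psi0 r : 0 <= r -> Qg [::] rs (emb r) -> 0 <= psi (emb r).
  move=> r0 Gr; have /lj[u uE] : gen (s ++ map emb rs) (emb r).
    by apply: gen_sub Gr => x xr; rewrite mem_cat xr orbT.
  rewrite -uE psiE; apply: iP; rewrite /= uE -(sqr_sqrtr r0) rmorphXn.
  exact: (precone_sqr HP).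
have [phi0 [[_ Hacc] sgn]] := approximable_exists gd Hpsi psi0 SG.
pose close rs' d (phi : F -> R) := hom_on (Qg s (rs ++ rs')) phi /\
  forall w, w \in S -> `|phi w - phi0 w| < d.
pose T : set F := [set u | exists rs' d, [/\ 0 < d, Qg s (rs ++ rs') u &
  forall phi, close rs' d phi -> 0 <= phi u]].
have GT x : exists rs', Qg s (rs ++ rs') x.
  by have [rs' xr] := fg x; exists rs'; apply: (Qgen_directed rs rs').2.
have close_cat rs1' rs2' d1 d2 phi : close (rs1' ++ rs2') (Num.min d1 d2) phi ->
    close rs1' d1 phi /\ close rs2' d2 phi.
  move=> [H1 H2]; split; split.
  - apply: hom_on_sub H1; apply: Qgen_sub => r; rewrite !mem_cat => /orP[->|->] //.
    by rewrite !orbT.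
  - by move=> w /H2; rewrite lt_min => /andP[].
  - apply: hom_on_sub H1; apply: Qgen_sub => r; rewrite !mem_cat => /orP[->|->] //.
    by rewrite !orbT.
  - by move=> w /H2; rewrite lt_min => /andP[].
have HT0 rs' := gen_subfield (s ++ map emb (rs ++ rs')).
have sub1 rs1' rs2' : Qg s (rs ++ rs1') `<=` Qg s (rs ++ (rs1' ++ rs2')).
  by rewrite catA; exact: (Qgen_directed _ _).1.
have sub2 rs1' rs2' : Qg s (rs ++ rs2') `<=` Qg s (rs ++ (rs1' ++ rs2')).
  by apply: Qgen_sub => r; rewrite !mem_cat => /orP[->|->] //; rewrite !orbT.
have homD rs' (phi : F -> R) x y : hom_on (Qg s (rs ++ rs')) phi -> Qg s (rs ++ rs') x -> Qg s (rs ++ rs') y ->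
    phi (x + y) = phi x + phi y.
  move=> [p1 pB pM] Gx Gy; have G0 := subfield0 (HT0 rs').
  have p0 : phi 0 = 0 by rewrite -(subrr 0) pB // subrr.
  have pN : phi (- y) = - phi y by rewrite -[in LHS]sub0r pB // p0 sub0r.
  by rewrite -{1}[y]opprK pB ?pN ?opprK //; exact: (subfieldN (HT0 rs')).
have [|Q [HQ TQ]] := @cone_extend F T.
  split.
  - move=> x; have [rs' xr] := GT x; exists rs', 1; split=> //.
      by rewrite expr2; exact: (subfieldM (HT0 rs')).
    by move=> phi [[_ _ pM] _]; rewrite expr2 pM // -expr2 sqr_ge0.
  - move=> x y [r1 [d1 [d10 G1 H1]]] [r2 [d2 [d20 G2 H2]]].
    exists (r1 ++ r2), (Num.min d1 d2); split; first by rewrite lt_min d10.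
      by apply: (subfieldD (HT0 _)); [exact: sub1|exact: sub2].
    move=> phi cl; have [c1 c2] := close_cat _ _ _ _ _ cl.
    rewrite (homD _ _ _ _ cl.1); [|exact: sub1|exact: sub2].
    exact: (addr_ge0 (H1 _ c1) (H2 _ c2)).
  - move=> x y [r1 [d1 [d10 G1 H1]]] [r2 [d2 [d20 G2 H2]]].
    exists (r1 ++ r2), (Num.min d1 d2); split; first by rewrite lt_min d10.
      by apply: (subfieldM (HT0 _)); [exact: sub1|exact: sub2].
    move=> phi cl; have [c1 c2] := close_cat _ _ _ _ _ cl.
    have [[_ _ pM] _] := cl; rewrite pM; [|exact: sub1|exact: sub2].
    exact: (mulr_ge0 (H1 _ c1) (H2 _ c2)).
  (* Approximability enters here: a homomorphism within the required distance exists, and it sends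
     -1 to -1. *)
  - move=> [r1 [d1 [d10 G1 H1]]].
    have [phi Hphi near] := Hacc d1 S r1 d10 SG.
    have := H1 phi (conj Hphi near); have [p1 pB pM] := Hphi.
    have G0 := subfield0 (HT0 r1); have G1' := subfield1 (HT0 r1).
    have p0 : phi 0 = 0 by rewrite -(subrr 0) pB // subrr.
    by rewrite -sub0r pB // p0 p1 sub0r; lra.
have [z [Hz zemb bnd pos]] := cone_place emb HQ.
exists z; split=> // x xS.
have Gx rs' : Qg s (rs ++ rs') x by apply: (Qgen_directed _ _).1; exact: SG.
(* Homomorphisms within 1 of [phi0] on [S] satisfy [|phi x| < n], so [n + x] and [n - x] both lie in
   [T]. *)
have [n xn] : exists n : nat, `|phi0 x| + 1 <= n%:R.
  exists (Num.truncn (`|phi0 x| + 1)).+1.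
  by rewrite ltW // truncnS_gt.
have inT y : (y = x \/ y = - x) -> T (emb n%:R + y).
  move=> yx; exists [::], 1; split=> //.
    apply: (subfieldD (HT0 _)).
      rewrite rmorph_nat; elim: (n) => [|m IHm]; first exact: (subfield0 (HT0 _)).
      by rewrite -natr1; exact: (subfieldD (HT0 _) IHm (subfield1 (HT0 _))).
    by case: yx => ->; [exact: Gx|exact: (subfieldN (HT0 _) (Gx _))].
  move=> phi [Hphi near]; have [p1 pB pM] := Hphi.
  have Gn m : Qg s (rs ++ [::]) (m%:R) /\ phi m%:R = m%:R.
    elim: m => [|m [IH1 IH2]].
      split; first exact: (subfield0 (HT0 _)).
      by rewrite -[X in phi X](subrr 1) pB ?subrr //; exact: (subfield1 (HT0 _)).
    split; rewrite -natr1; first exact: (subfieldD (HT0 _) IH1 (subfield1 (HT0 _))).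
    by rewrite (homD _ _ _ _ Hphi) // ?IH2 ?p1 ?natr1 //; exact: (subfield1 (HT0 _)).
  have [Gnn pn] := Gn n; have [G0 p0] := Gn 0%N.
  rewrite rmorph_nat.
  have := near _ xS; have h1 := ler_norm (phi0 x); have h2 : - phi0 x <= `|phi0 x| by rewrite -normrN ler_norm.
  case: yx => ->.
    rewrite (homD _ _ _ _ Hphi) // pn ltr_norml => /andP[].
    by lra.
  rewrite pB // pn ltr_norml => /andP[].
  by lra.
have [r zr] := bnd x n%:R (TQ _ (inT _ (or_intror erefl))) (TQ _ (inT _ (or_introl erefl))).
exists r; split=> // Px; apply: pos zr; apply: TQ.
have [u uE] : exists u, j u = x by apply/lj; exact: SG.
have psix : 0 <= psi x by rewrite -uE psiE; apply: iP; rewrite /= uE.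
have phix : 0 <= phi0 x by rewrite -sgz_ge0 -sgn // sgz_ge0.
(* If [phi0 x = 0], equality of signs gives [psi x = 0] and hence [x = 0]; otherwise homomorphisms
   within distance [phi0 x] are positive at [x]. *)
have [x0|x0] := eqVneq (phi0 x) 0.
  exists [::], 1; split=> // phi [Hphi _].
  have : psi x = 0 by apply/eqP; rewrite -sgz_eq0 sgn // x0 sgz0.
  rewrite -uE psiE => /eqP; rewrite fmorph_eq0 => /eqP->; rewrite rmorph0.
  have [p1 pB pM] := Hphi; have G0 := subfield0 (HT0 [::]).
  by rewrite -[X in phi X](subrr 0) pB // subrr.
exists [::], (phi0 x); split=> //; first by rewrite lt_neqAle eq_sym x0.
move=> phi [_ near]; have := near _ xS; rewrite ltr_norml => /andP[]; lra.
Qed.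
End FinitePlace.

(** * Linear disjointness *)

Section LinDisjoint.
Variables (R : realType) (F : fieldType) (emb : {rmorphism R -> F}).

Definition indep n (a : 'I_n -> F) :=
  forall c : 'I_n -> R, \sum_i emb (c i) * a i = 0 -> forall i, c i = 0.

Lemma not_indep n (a : 'I_n.+1 -> F) : ~ indep a ->
  exists j (d : 'I_n -> R), a j = - \sum_i emb (d i) * a (lift j i).
Proof.
move=> na; have [c [Ec [j cj]]] : exists c : 'I_n.+1 -> R,
    \sum_i emb (c i) * a i = 0 /\ exists j, c j != 0.
  apply: contrapT => H; apply: na => c Ec i; apply: contrapT => ci.
  by apply: H; exists c; split=> //; exists i; apply/eqP.
exists j, (fun i => c (lift j i) / c j).
have ecj : emb (c j) != 0 by rewrite fmorph_eq0.
apply: (mulfI ecj); rewrite mulrN mulr_sumr.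
rewrite (bigD1_ord j) //= in Ec; apply/eqP; rewrite -subr_eq0 opprK -[X in _ == X]Ec.
apply/eqP; congr (_ + _); apply: eq_bigr => i _.
by rewrite fmorph_div; field.
Qed.

Lemma sum_eliminate n (a b : 'I_n.+1 -> F) j (d : 'I_n -> R) :
  a j = - \sum_i emb (d i) * a (lift j i) ->
  \sum_i a i * b i = \sum_i a (lift j i) * (b (lift j i) - emb (d i) * b j).
Proof.
move=> aj; rewrite (bigD1_ord j) //= aj mulNr mulr_suml addrC -sumrB.
by apply: eq_bigr => i _; ring.
Qed.

(** An independent family [a] would make all [b i] zero, against their independence. A dependent one
    lets a term be eliminated while the new coefficients in [K2] stay independent. *)
Lemma lin_disjoint_sym (K1 K2 : set F) : is_Rsubfield emb K2 ->
  lin_disjoint emb K1 K2 -> lin_disjoint emb K2 K1.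
Proof.
move=> HK2 ld n b a K2b K1a ib ab0.
have {}ab0 : \sum_i a i * b i = 0.
  by rewrite -[RHS]ab0; apply: eq_bigr => i _; rewrite mulrC.
elim: n a b K1a K2b ib ab0 => [|n IHn] a b K1a K2b ib ab0; first by case.
have [ia|/not_indep[j [d aj]]] := pselect (indep a).
  have b0 := ld _ _ _ K1a K2b ia ab0.
  have := ib (fun _ => 1); rewrite big1 => [/(_ erefl ord0)/eqP|i _].
    by rewrite oner_eq0.
  by rewrite b0 mulr0.
have [Kemb [KBM _]] := HK2.
have K2b' i : K2 (b (lift j i) - emb (d i) * b j).
  by apply: (KBM _ _ _ _).1 => //; apply: (KBM _ _ _ _).2.
have al0 := IHn (fun i => a (lift j i)) _ (fun i => K1a (lift j i)) K2b' _ _.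
have {}al0 : forall i, a (lift j i) = 0.
  apply: al0; last by rewrite -(sum_eliminate _ aj).
  move=> c Ec i.
  (* The relation among the original [b i] that corresponds to the relation [c] among the
     [b (lift j i) - d i b j]. *)
  pose c' k := if unlift j k is Some k' then c k' else - \sum_i' c i' * d i'.
  have := ib c'; rewrite (bigD1_ord j) //= {1}/c' unlift_none.
  under eq_bigr => k _ do rewrite /c' liftK.
  move=> H; have := H _ (lift j i); rewrite /c' liftK; apply.
  rewrite -[RHS]Ec rmorphN rmorph_sum mulNr mulr_suml addrC -sumrB.
  by apply: eq_bigr => k _; rewrite rmorphM; ring.
move=> i; have [k ->|->] := unliftP j i; first exact: al0.
by rewrite aj big1 ?oppr0 // => k _; rewrite al0 mulr0.
Qed.

(* The pairs [(e, r)] of values of the same formal sum [\sum_i a_i (x) b_i], with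
   [a_i] in [K1], where [b_i] is sent to the first resp. second component of a pair
   related by [B]. *)
Definition tensor_rel (K1 : set F) (B : F -> F -> Prop) (e r : F) :=
  exists l : seq (F * (F * F)), [/\ forall t, t \in l -> K1 t.1 /\ B t.2.1 t.2.2,
    e = \sum_(t <- l) t.1 * t.2.1 & r = \sum_(t <- l) t.1 * t.2.2].

Section TensorRel.
Variables (K1 : set F) (B : F -> F -> Prop).

Lemma tensor_rel_in a b r : K1 a -> B b r -> tensor_rel K1 B (a * b) (a * r).
Proof.
by move=> Ka Bbr; exists [:: (a, (b, r))]; rewrite !big_seq1; split=> // t; rewrite inE => /eqP->.
Qed.

Lemma tensor_relD e r e' r' : tensor_rel K1 B e r -> tensor_rel K1 B e' r' ->
  tensor_rel K1 B (e + e') (r + r').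
Proof.
move=> [l [Hl -> ->]] [l' [Hl' -> ->]]; exists (l ++ l'); rewrite !big_cat; split=> // t.
by rewrite mem_cat => /orP[/Hl|/Hl'].
Qed.

Lemma tensor_relM e r e' r' :
  (forall a b, K1 a -> K1 b -> K1 (a * b)) ->
  (forall b s b' s', B b s -> B b' s' -> B (b * b') (s * s')) ->
  tensor_rel K1 B e r -> tensor_rel K1 B e' r' -> tensor_rel K1 B (e * e') (r * r').
Proof.
move=> K1M BM [l [Hl -> ->]] [l' [Hl' -> ->]].
exists [seq (t.1 * u.1, (t.2.1 * u.2.1, t.2.2 * u.2.2)) | t <- l, u <- l']; split.
- move=> t /allpairsP[[u v] [/Hl[? ?] /Hl'[? ?] ->]] /=; split; [exact: K1M|exact: BM].
- rewrite big_allpairs_dep big_distrlr; apply: eq_bigr => t _; apply: eq_bigr => u _ /=.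
  by rewrite mulrACA.
- rewrite big_allpairs_dep big_distrlr; apply: eq_bigr => t _; apply: eq_bigr => u _ /=.
  by rewrite mulrACA.
Qed.

(** A dependence among the left factors eliminates one of them from both sums at once; [B], being
    linear over R, still relates the new right factors. *)
Lemma tensor_rel_indep e r :
  (forall b s b' s' d, B b s -> B b' s' -> B (b - emb d * b') (s - emb d * s')) ->
  tensor_rel K1 B e r -> exists n (a : 'I_n -> F) (b s : 'I_n -> F),
    [/\ indep a, forall i, K1 (a i), forall i, B (b i) (s i),
        e = \sum_i a i * b i & r = \sum_i a i * s i].
Proof.
move=> BD [l [Hl eE rE]].
rewrite big_tnth in eE; rewrite big_tnth in rE.
pose T i := tnth (in_tuple l) i.
have HT i : K1 (T i).1 /\ B (T i).2.1 (T i).2.2 by apply: Hl; apply: mem_tnth.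
move: eE rE; pose a i := (T i).1; pose b i := (T i).2.1; pose s i := (T i).2.2.
rewrite -/(\sum_i a i * b i) -/(\sum_i a i * s i).
have Ka i : K1 (a i) by case: (HT i).
have Bbs i : B (b i) (s i) by case: (HT i).
move: (size l) a b s Ka Bbs => n {Hl HT T} a b s Ka Bbs.
elim: n a b s Ka Bbs => [|n IHn] a b s Ka Bbs eE rE.
  by exists 0%N, a, b, s; split=> // c _ [].
have [ia|/not_indep[j [d aj]]] := pselect (indep a); first by exists n.+1, a, b, s.
apply: (IHn (fun i => a (lift j i)) (fun i => b (lift j i) - emb (d i) * b j)
  (fun i => s (lift j i) - emb (d i) * s j)) => //.
- by move=> i; apply: BD.
- by rewrite eE (sum_eliminate _ aj).
- by rewrite rE (sum_eliminate _ aj).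
Qed.
End TensorRel.
End LinDisjoint.

(** * Fibres of the restriction map *)

Section Fibre.
Variables (R : realType) (F : fieldType) (emb : {rmorphism R -> F}) (F1 F2 : set F).
Hypotheses (HF1 : is_Rsubfield emb F1) (HF2 : is_Rsubfield emb F2).

Section RSub.
Variable K : set F.
Hypothesis HK : is_Rsubfield emb K.
Lemma Rsub_emb r : K (emb r). Proof. by case: HK. Qed.
Lemma RsubB x y : K x -> K y -> K (x - y).
Proof. by case: HK => _ [H _] Kx Ky; case: (H x y Kx Ky). Qed.
Lemma RsubM x y : K x -> K y -> K (x * y).
Proof. by case: HK => _ [H _] Kx Ky; case: (H x y Kx Ky). Qed.
Lemma RsubV x : K x -> K x^-1. Proof. by case: HK => _ [_]; apply. Qed.
Lemma Rsub1 : K 1. Proof. by rewrite -(rmorph1 emb); exact: Rsub_emb. Qed.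
Lemma Rsub0 : K 0. Proof. by rewrite -(rmorph0 emb); exact: Rsub_emb. Qed.
Lemma RsubN x : K x -> K (- x).
Proof. by move=> Kx; rewrite -sub0r; exact: (RsubB Rsub0 Kx). Qed.
End RSub.

(* [r] plays no role here: [e] ranges over the subring generated by [F1] and [F2]. *)
Definition span2 (e : F) := exists r, tensor_rel F1 (fun b _ => F2 b) e r.

Lemma span2M x y : span2 x -> span2 y -> span2 (x * y).
Proof.
move=> [r xr] [s ys]; exists (r * s); apply: tensor_relM xr ys; first exact: (RsubM HF1).
by move=> b _ b' _; exact: (RsubM HF2).
Qed.

Lemma span2D x y : span2 x -> span2 y -> span2 (x + y).
Proof. by move=> [r xr] [s ys]; exists (r + s); apply: tensor_relD. Qed.

Lemma span2_l a : F1 a -> span2 a.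
Proof.
by move=> Fa; exists (a * 0); rewrite -[X in tensor_rel _ _ X _]mulr1;
   apply: tensor_rel_in => //; exact: (Rsub1 HF2).
Qed.

Lemma span2_r b : F2 b -> span2 b.
Proof.
by move=> Fb; exists (1 * 0); rewrite -[X in tensor_rel _ _ X _]mul1r;
   apply: tensor_rel_in => //; exact: (Rsub1 HF1).
Qed.

Lemma span2N x : span2 x -> span2 (- x).
Proof.
by rewrite -mulN1r; apply: span2M; apply: span2_l; exact: (RsubN HF1 (Rsub1 HF1)).
Qed.

Hypothesis F12 : gen_field emb (F1 `|` F2) = setT.

Lemma span2_frac u : exists e e', [/\ span2 e, span2 e', e' != 0 & u = e / e'].
Proof.
pose K : set F := [set u | exists e e', [/\ span2 e, span2 e', e' != 0 & u = e / e']].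
have s1 : span2 1 by apply: span2_l; exact: (Rsub1 HF1).
have : gen_field emb (F1 `|` F2) u by rewrite F12.
move=> /(_ K); apply.
  split; first by move=> r; exists (emb r), 1; rewrite divr1 oner_neq0; split=> //;
    apply: span2_l; exact: (Rsub_emb HF1).
  split=> [x y [e [e' [se se' e0 ->]]] [f [f' [sf sf' f0 ->]]]|x [e [e' [se se' e0 ->]]]].
    split.
      exists (e * f' - f * e'), (e' * f'); split; last by field; rewrite e0 f0.
      - by apply: span2D; [exact: span2M|apply: span2N; exact: span2M].
      - exact: span2M.
      - by rewrite mulf_neq0.
    exists (e * f), (e' * f'); split; last by field; rewrite e0 f0.
    - exact: span2M.
    - exact: span2M.
    - by rewrite mulf_neq0.
  have [->|en0] := eqVneq e 0.
    exists 0, 1; rewrite mul0r invr0 divr1 oner_neq0; split=> //.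
    by apply: span2_l; exact: (Rsub0 HF1).
  by exists e', e; rewrite invf_div.
by move=> x [] Fx; exists x, 1; rewrite divr1 oner_neq0; split=> //; [exact: span2_l|exact: span2_r].
Qed.

Variable z : F -> option R.
Hypotheses (Hz : Rplace (@id F) z) (zemb : forall r, z (emb r) = Some r).
Hypothesis ld : lin_disjoint emb F1 F2.

Definition finres b s := F2 b /\ exists2 c, z b = Some c & s = emb c.

(* [res e r]: the extension to [F] of the restriction of [z] to [F2], trivial on [F1],
   maps [e] to [r] in [F1]. *)
Definition res := tensor_rel F1 finres.

Lemma finresM b s b' s' : finres b s -> finres b' s' -> finres (b * b') (s * s').
Proof.
move=> [Fb [c zb ->]] [Fb' [c' zb' ->]]; split; first exact: (RsubM HF2).
by exists (c * c'); [exact: placeM|rewrite rmorphM].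
Qed.

Lemma finres_lin b s b' s' d : finres b s -> finres b' s' ->
  finres (b - emb d * b') (s - emb d * s').
Proof.
move=> [Fb [c zb ->]] [Fb' [c' zb' ->]]; split.
  by apply: (RsubB HF2) => //; apply: (RsubM HF2) => //; exact: (Rsub_emb HF2).
exists (c - d * c'); last by rewrite rmorphB rmorphM.
by apply: placeD => //; apply: placeN => //; apply: placeM.
Qed.

Lemma resM e r e' r' : res e r -> res e' r' -> res (e * e') (r * r').
Proof. by apply: tensor_relM; [exact: (RsubM HF1)|exact: finresM]. Qed.

Lemma resD e r e' r' : res e r -> res e' r' -> res (e + e') (r + r').
Proof. exact: tensor_relD. Qed.

Lemma finres1 : finres 1 1.
Proof. by split; [exact: (Rsub1 HF2)|exists 1; rewrite ?rmorph1 //; apply: place1]. Qed.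

Lemma res_l a : F1 a -> res a a.
Proof. by move=> Fa; have := tensor_rel_in Fa finres1; rewrite mulr1. Qed.

Lemma res_r b c : F2 b -> z b = Some c -> res b (emb c).
Proof.
move=> Fb zb; rewrite -[b]mul1r -[emb c]mul1r.
by apply: tensor_rel_in; [exact: (Rsub1 HF1)|split=> //; exists c].
Qed.

(** Once the left factors are independent, linear disjointness makes every right factor of a zero
    sum vanish, hence also its residue. *)
Lemma res0 r : res 0 r -> r = 0.
Proof.
move=> /(tensor_rel_indep finres_lin)[n [a [b [s [ia Fa Bbs e0 ->]]]]].
apply: big1 => i _; have [Fb [c zb ->]] := Bbs i.
have b0 := ld Fa (fun i => (Bbs i).1) ia (esym e0) i.
by move: zb; rewrite b0 (place0 Hz) => -[<-]; rewrite rmorph0 mulr0.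
Qed.

Lemma res_uniq e r r' : res e r -> res e r' -> r = r'.
Proof.
move=> er er'; apply/eqP; rewrite -subr_eq0; apply/eqP/res0.
have Nres := resM (res_l (RsubN HF1 (Rsub1 HF1))) er'.
by have := resD er Nres; rewrite !mulN1r subrr.
Qed.

(** An entry of least valuation, found by comparing two entries at a time. *)
Lemma dominant (n : nat) (b : 'I_n -> F) : (exists i, b i != 0) ->
  exists2 m, b m != 0 & forall i, exists c, z (b i / b m) = Some c.
Proof.
elim: n b => [|n IHn] b [i0 bi0]; first by case: i0 bi0.
have [[i bi]|no] := pselect (exists i : 'I_n, b (lift ord0 i) != 0); last first.
  exists ord0.
    have [j E|E] := unliftP ord0 i0; last by rewrite -E.
    by case: no; exists j; rewrite -E.
  move=> i; have [j ->|->] := unliftP ord0 i.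
    exists 0; have -> : b (lift ord0 j) = 0.
      by apply: contrapT => bj; case: no; exists j; apply/eqP.
    by rewrite mul0r; apply: place0.
  have b0 : b ord0 != 0.
    have [j E|E] := unliftP ord0 i0; last by rewrite -E.
    by case: no; exists j; rewrite -E.
  by exists 1; rewrite divff //; apply: place1.
have [m bm Hm] := IHn (fun i => b (lift ord0 i)) (ex_intro _ i bi).
case: (place_total Hz (b ord0) bm) => [[c0 zc0]|[b0 zm]].
  exists (lift ord0 m) => // k; have [j ->|->] := unliftP ord0 k; first exact: Hm.
  by exists c0.
exists ord0 => // k; have [j ->|->] := unliftP ord0 k; last first.
  by exists 1; rewrite divff //; apply: place1.
have [c zc] := Hm j; exists (c * 0).
have -> : b (lift ord0 j) / b ord0 = b (lift ord0 j) / b (lift ord0 m) * (b (lift ord0 m) / b ord0).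
  by field; rewrite b0 bm.
exact: placeM.
Qed.

(** After division by a dominant right factor, one right factor is 1; the left factors being
    independent, the residue cannot vanish. *)
Lemma res_normalize e : span2 e -> e != 0 ->
  exists b e1 r, [/\ F2 b, b != 0, e = b * e1, res e1 r & r != 0].
Proof.
move=> [r0 He] e0.
have BD (b _ b' _ : F) d : F2 b -> F2 b' -> F2 (b - emb d * b') :=
  fun Fb Fb' => RsubB HF2 Fb (RsubM HF2 (Rsub_emb HF2 d) Fb').
have [n [a [b [s [ia Fa Fb eE _]]]]] := tensor_rel_indep (emb := emb)
  BD He.
have [|m bm /choice[c zc]] := @dominant n b.
  apply: contrapT => H; case/eqP: e0; rewrite eE big1 // => i _.
  have -> : b i = 0 by apply: contrapT => bi; apply: H; exists i; apply/eqP.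
  by rewrite mulr0.
exists (b m), (\sum_i a i * (b i / b m)), (\sum_i a i * emb (c i)); split=> //.
- by rewrite eE mulr_sumr; apply: eq_bigr => i _; rewrite mulrCA [b m * _]mulrC divfK.
- exists [seq (a i, (b i / b m, emb (c i))) | i <- enum 'I_n]; split.
  + move=> t /mapP[i _ ->] /=; split=> //; split; first exact: (RsubM HF2 (Fb i) (RsubV HF2 (Fb m))).
    by exists (c i).
  + by rewrite big_map big_enum.
  + by rewrite big_map big_enum.
apply/eqP => r_eq0; have cm : c m = 1.
  by have := zc m; rewrite divff // (place1 Hz) => -[].
have := ia c _ m; rewrite cm => H; suff /eqP : (1 : R) = 0 by rewrite oner_eq0.
by apply: H; rewrite -[RHS]r_eq0; apply: eq_bigr => i _; rewrite mulrC.
Qed.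

(* The composite of the place [res] of [F] with values in [F1] and of [z] on [F1]. *)
Definition comp_rel u t := exists e e' r r',
  [/\ res e r, res e' r', r' != 0, u = e / e' & z (r / r') = t].

Lemma res_neq0 e r : res e r -> r != 0 -> e != 0.
Proof. by move=> er r0; apply: contra_neq r0 => e0; rewrite e0 in er; exact: res0. Qed.

Lemma comp_uniq u t t' : comp_rel u t -> comp_rel u t' -> t = t'.
Proof.
move=> [e [e' [r [r' [er er' r0 -> <-]]]]] [f [f' [q [q' [fq fq' q0 E <-]]]]].
have e0 := res_neq0 er' r0; have f0 := res_neq0 fq' q0.
congr z; apply/eqP; rewrite eqr_div //; apply/eqP.
apply: (res_uniq (e := e * f')); first exact: resM.
have -> : e * f' = f * e' by apply/eqP; rewrite -eqr_div // E.
exact: resM.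
Qed.

(* The fibre over [(z|F1, z|F2)] contains a place for which [F2] is infinitesimal
   with respect to [F1]. *)
Lemma fibre_place : exists z' : F -> option R,
  [/\ Rplace (@id F) z', forall a, F1 a -> z' a = z a, forall b, F2 b -> z' b = z b &
      forall x y, F1 x -> x != 0 -> F2 y -> z y = Some 0 -> z' (y / x) = Some 0].
Proof.
(* Infinity arises in two ways: [u] has infinite residue and is related to nothing, or its residue
   has infinite value under [z]. *)
have H u : exists t, (forall t', comp_rel u t' -> t' = t) /\
    (t <> None -> comp_rel u t).
  have [[t ut]|no] := pselect (exists t, comp_rel u t).
    by exists t; split=> // t' /comp_uniq; apply.
  by exists None; split=> // t ut; case: no; exists t.
have [z' z'P] := choice H.
have z'E u t : comp_rel u t -> z' u = t by move=> /(z'P u).1.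
have z'S u a : z' u = Some a -> comp_rel u (Some a).
  by move=> E; rewrite -E; apply: (z'P u).2; rewrite E.
have res1 : res 1 1 by apply: res_l; exact: (Rsub1 HF1).
have z'1 a : F1 a -> z' a = z a.
  by move=> Fa; apply: z'E; exists a, 1, a, 1; rewrite !divr1 oner_neq0; split=> //; exact: res_l.
have z'2 b c : F2 b -> z b = Some c -> z' b = Some c.
  move=> Fb zb; apply: z'E; exists b, 1, (emb c), 1; rewrite !divr1 oner_neq0; split=> //.
  exact: res_r.
(* Normalization gives [u = b e / e'] with [b] in [F2] and [e], [e'] of nonzero residue, so the
   value of [b] decides: infinite, 0, or a nonzero real. *)
have inv u v : u * v = 1 -> z' u = None <-> z' v = Some 0.
  move=> uv; have u0 : u != 0 by apply/eqP => u0; move/eqP: uv; rewrite u0 mul0r eq_sym oner_eq0.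
  have vE : v = u^-1 by apply: (mulfI u0); rewrite uv mulfV.
  have [x [y [sx sy y0 uE]]] := span2_frac u.
  have x0 : x != 0 by apply: contra_neq u0 => x0; rewrite uE x0 mul0r.
  have [b1 [e [r [Fb1 b10 xE er r0]]]] := res_normalize sx x0.
  have [b2 [e' [r' [Fb2 b20 yE er' r0']]]] := res_normalize sy y0.
  have e0 := res_neq0 er r0; have e0' := res_neq0 er' r0'.
  pose b := b1 / b2; have Fb : F2 b := RsubM HF2 Fb1 (RsubV HF2 Fb2).
  have b0 : b != 0 by rewrite mulf_neq0 ?invr_eq0.
  have {uE}uE : u = b * e / e' by rewrite uE xE yE /b; field; rewrite e0' b20.
  have {vE}vE : v = b^-1 * e' / e by rewrite vE uE; field; rewrite e0 e0' b0.
  have Fbv := RsubV HF2 Fb.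
  case zb : (z b) => [c|]; last first.
    have zbv := (placeV_None Hz b0).1 zb.
    have zv : z' v = Some 0.
      apply: z'E; exists (b^-1 * e'), e, (emb 0 * r'), r; split=> //.
        by apply: resM er'; exact: res_r.
      by rewrite rmorph0 !mul0r (place0 Hz).
    split=> // _; case zu : (z' u) => [a|//]; have [f [f' [q [q' [fq fq' q0 E _]]]]] := z'S _ _ zu.
    have f0' := res_neq0 fq' q0.
    have P : f * (b^-1 * e') = e * f'.
      apply: (mulfI (invr_neq0 f0')); rewrite mulrCA mulrA -E.
      by rewrite uE; field; rewrite f0' e0' b0.
    have := res_uniq (resM fq (resM (res_r Fbv zbv) er')); rewrite P => /(_ _ (resM er fq')).
    by rewrite rmorph0 mul0r mulr0 => /esym/eqP; rewrite mulf_eq0 (negPf r0) (negPf q0).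
  have [c0|c0] := eqVneq c 0.
    rewrite c0 in zb.
    have zu : z' u = Some 0.
      apply: z'E; exists (b * e), e', (emb 0 * r), r'; split=> //.
        by apply: resM er; exact: res_r.
      by rewrite rmorph0 !mul0r (place0 Hz).
    rewrite zu; split=> // zv; have [f [f' [q [q' [fq fq' q0 E _]]]]] := z'S _ _ zv.
    have f0' := res_neq0 fq' q0.
    have P : f * (b * e) = e' * f'.
      apply: (mulfI (invr_neq0 f0')); rewrite mulrCA mulrA -E.
      by rewrite vE; field; rewrite f0' e0 b0.
    have := res_uniq (resM fq (resM (res_r Fb zb) er)); rewrite P => /(_ _ (resM er' fq')).
    by rewrite rmorph0 mul0r mulr0 => /esym/eqP; rewrite mulf_eq0 (negPf r0') (negPf q0).
  have ec0 : emb c != 0 by rewrite fmorph_eq0.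
  have -> : z' u = z (emb c * r / r').
    by apply: z'E; exists (b * e), e', (emb c * r), r'; split=> //; apply: resM er; exact: res_r.
  have -> : z' v = z (emb c * r / r')^-1.
    apply: z'E; exists (b^-1 * e'), e, (emb c^-1 * r'), r; split=> //.
      by apply: resM er'; apply: res_r Fbv _; exact: (placeV Hz).
    by congr z; rewrite fmorphV; field; rewrite ec0 r0 r0'.
  by apply: (placeV_None Hz); rewrite !mulf_neq0 ?invr_eq0.
exists z'; split=> //.
- split; first by move=> u ->; rewrite z'1 ?(place1 Hz) //; exact: (Rsub1 HF1).
  split.
    move=> u v w a b /z'S[e [e' [r [r' [er er' r0 -> zr]]]]].
    move=> /z'S[f [f' [q [q' [fq fq' q0 -> zq]]]]] ->; apply: z'E.
    have e0 := res_neq0 er' r0; have f0 := res_neq0 fq' q0.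
    exists (e * f' + f * e'), (e' * f'), (r * q' + q * r'), (r' * q'); split.
    - by apply: resD; exact: resM.
    - exact: resM.
    - by rewrite mulf_neq0.
    - by field; rewrite e0 f0.
    - have -> : (r * q' + q * r') / (r' * q') = r / r' + q / q' by field; rewrite r0 q0.
      exact: placeD.
  split=> //.
  move=> u v w a b /z'S[e [e' [r [r' [er er' r0 -> zr]]]]].
  move=> /z'S[f [f' [q [q' [fq fq' q0 -> zq]]]]] ->; apply: z'E.
  have e0 := res_neq0 er' r0; have f0 := res_neq0 fq' q0.
  exists (e * f), (e' * f'), (r * q), (r' * q'); split.
  - exact: resM.
  - exact: resM.
  - by rewrite mulf_neq0.
  - by field; rewrite e0 f0.
  - have -> : (r * q) / (r' * q') = r / r' * (q / q') by field; rewrite r0 q0.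
    exact: placeM.
- move=> b Fb; case zb : (z b) => [c|]; first exact: z'2.
  have b0 : b != 0 by apply/eqP => b0; move: zb; rewrite b0 (place0 Hz).
  apply/(inv _ _ (mulfV b0)); apply: z'2; first exact: (RsubV HF2).
  exact/(placeV_None Hz b0).
move=> x y Fx x0 Fy zy; apply: z'E; exists y, x, (emb 0), x; split=> //.
- exact: res_r.
- exact: res_l.
- by rewrite rmorph0 mul0r (place0 Hz).
Qed.
End Fibre.

(** * Density and the complement of the image *)

Section PlacesInBasicOpen.
Variables (R : realType) (F : fieldType) (emb : {rmorphism R -> F}) (F1 F2 : set F).
Hypotheses (HF1 : is_Rsubfield emb F1) (HF2 : is_Rsubfield emb F2).
Hypothesis F12 : gen_field emb (F1 `|` F2) = setT.

Definition finite_on (z : F -> option R) (S : seq F) :=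
  forall x, x \in S -> exists r, z x = Some r.

Definition same_restr (z z' : F -> option R) :=
  (forall a, F1 a -> z' a = z a) /\ (forall b, F2 b -> z' b = z b).

(** [S] lists the factors in a formal sum for [e]; if they are finite, the restrictions determine
    the value of the sum. *)
Lemma span2_agree e : span2 F1 F2 e -> exists S : seq F, forall z z',
  Rplace (@id F) z -> Rplace (@id F) z' -> same_restr z z' -> finite_on z S ->
  exists c, z e = Some c /\ z' e = Some c.
Proof.
move=> [_ [l [Hl -> _]]]; elim: l Hl => [|t l IHl] Hl.
  exists [::] => z z' Hz Hz' _ _; exists 0; rewrite big_nil.
  by rewrite (place0 Hz) (place0 Hz').
have [|S HS] := IHl; first by move=> u ul; apply: Hl; rewrite inE ul orbT.
have [Ft1 Ft2] := Hl t (mem_head _ _).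
exists (t.1 :: t.2.1 :: S) => z z' Hz Hz' zz' fin.
have [|c [zc z'c]] := HS z z' Hz Hz' zz'; first by move=> x xS; apply: fin; rewrite !inE xS !orbT.
have [|r1 zr1] := fin t.1; first by rewrite !inE eqxx.
have [|r2 zr2] := fin t.2.1; first by rewrite !inE eqxx orbT.
exists (r1 * r2 + c); rewrite big_cons; split.
  by apply: (placeD Hz) => //; apply: (placeM Hz).
have [z1 z2] := zz'.
by apply: (placeD Hz') => //; apply: (placeM Hz'); rewrite ?(z1 _ Ft1) ?(z2 _ Ft2).
Qed.

(** Finiteness at [e'^-1] and [b^-1] makes the values at [e'] and [b] nonzero: the first lets the
    fraction be evaluated at [z'], the second turns the weak sign at [b] into a strict one. *)
Lemma Hsub_agree (P : set F) b : P b -> b != 0 -> exists S : seq F, forall z z',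
  Rplace (@id F) z -> Rplace (@id F) z' -> same_restr z z' ->
  (forall x, x \in S -> exists r, z x = Some r /\ (P x -> 0 <= r)) -> Hsub b z'.
Proof.
move=> Pb b0; have [e [e' [se se' e0' bE]]] := span2_frac HF1 HF2 F12 b.
have [S1 H1] := span2_agree se; have [S2 H2] := span2_agree se'.
exists (b :: b^-1 :: e'^-1 :: S1 ++ S2) => z z' Hz Hz' zz' fin.
have [|c [zc z'c]] := H1 z z' Hz Hz' zz'.
  by move=> x xS; have [|r [zr _]] := fin x; [rewrite !inE mem_cat xS !orbT|exists r].
have [|c' [zc' z'c']] := H2 z z' Hz Hz' zz'.
  by move=> x xS; have [|r [zr _]] := fin x; [rewrite !inE mem_cat xS !orbT|exists r].
have unit u a : u != 0 -> z u = Some a -> (exists r, z u^-1 = Some r) -> a != 0.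
  move=> u0 zu [r zr]; have := placeM Hz zu zr.
  rewrite mulfV // (place1 Hz) => -[ar]; apply/eqP => a0.
  by move/eqP: ar; rewrite a0 mul0r oner_eq0.
have c0' : c' != 0.
  apply: unit zc' _ => //; have [|r [zr _]] := fin e'^-1; last by exists r.
  by rewrite !inE eqxx !orbT.
have zb : z b = Some (c * c'^-1).
  by rewrite bE; apply: (placeM Hz) => //; apply: (placeV Hz).
have z'b : z' b = Some (c * c'^-1).
  by rewrite bE; apply: (placeM Hz') => //; apply: (placeV Hz').
split=> //; exists (c * c'^-1); split=> //.
have cn0 : c * c'^-1 != 0.
  apply: unit zb _ => //; have [|r [zr _]] := fin b^-1; last by exists r.
  by rewrite !inE eqxx !orbT.
rewrite lt_neqAle eq_sym cn0 /=; have [|r [zr r0]] := fin b; first exact: mem_head.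
by move: zr; rewrite zb => -[->]; exact: r0.
Qed.

Variables (s : seq F).
Hypothesis fg : forall x, exists rs, Qgen emb s rs x.
Variables (x : F).
Hypothesis (tx : forall p : {poly R}, p != 0 -> (map_poly emb p).[x] != 0).

Lemma basic_open_contains_fibre (bs : seq F) (vals : seq R) : basic_open (R := R) bs !=set0 ->
  exists z, [/\ Rplace (@id F) z, forall r, z (emb r) = Some r,
    exists2 a, z x = Some a & a \notin vals &
    forall z', Rplace (@id F) z' -> same_restr z z' -> basic_open (R := R) bs z'].
Proof.
move=> [xi [Hxi xibs]]; have [P [HP PV]] := place_cone Hxi.
have [S HS] : exists S : seq F, forall z z',
    Rplace (@id F) z -> Rplace (@id F) z' -> same_restr z z' ->
    (forall x, x \in S -> exists r, z x = Some r /\ (P x -> 0 <= r)) ->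
    forall b, b \in bs -> Hsub b z'.
  elim: bs xibs => [|b bs IHbs] xibs; first by exists [::].
  have [|S1 H1] := IHbs; first by move=> b' bs'; apply: xibs; rewrite inE bs' orbT.
  have [_ [r [xib r0]]] := xibs b (mem_head _ _).
  have [||S2 H2] := @Hsub_agree P b _ _.
  - exact: PV xib r0.
  - by apply: contraTneq r0 => b0; move: xib; rewrite b0 (place0 Hxi) => -[<-]; rewrite ltxx.
  exists (S1 ++ S2) => z z' Hz Hz' zz' fin b'; rewrite inE => /orP[/eqP->|bs'].
    by apply: (H2 z) => // y yS; apply: fin; rewrite mem_cat yS orbT.
  by apply: (H1 z) => // y yS; apply: fin; rewrite mem_cat yS.
(* Finiteness at [(x - v)^-1] keeps the value at [x] different from [v]; transcendence of [x]
   ensures that [x - v] is nonzero. *)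
pose X := x :: [seq (x - emb v)^-1 | v <- vals].
have [z [Hz zemb fin]] := finite_place fg (X ++ S) HP.
have [|a [za _]] := fin x; first by rewrite inE eqxx.
exists z; split=> //; last first.
  move=> z' Hz' zz'; split=> //; apply: (HS z) => // y yS.
  by apply: fin; rewrite mem_cat yS orbT.
exists a => //; apply/negP => av.
have [|r [zr _]] := fin (x - emb a)^-1.
  by rewrite mem_cat inE; apply/orP; left; apply/orP; right; apply/mapP; exists a.
have xa0 : x - emb a != 0.
  have := @tx ('X - a%:P); rewrite polyXsubC_eq0 => /(_ isT).
  by rewrite rmorphB /= map_polyX map_polyC hornerXsubC.
have := placeM Hz (placeD Hz za (placeN Hz (zemb a))) zr.
by rewrite subrr mul0r mulfV // (place1 Hz) => -[/eqP]; rewrite oner_eq0.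
Qed.
End PlacesInBasicOpen.

(** From a transcendental element, subtract its value if finite and take the inverse otherwise. *)
Lemma infinitesimal_exists (R : realType) (F : fieldType) (emb : {rmorphism R -> F}) (K : set F)
    (z : F -> option R) : is_Rsubfield emb K -> Rplace (@id F) z ->
  (forall r, z (emb r) = Some r) -> trdeg_ge1 emb K ->
  exists y, [/\ K y, y != 0 & z y = Some 0].
Proof.
move=> HK Hz zemb [y [Ky ty]]; case zy : (z y) => [c|].
  exists (y - emb c); split.
  - by apply: (RsubB HK) => //; exact: (Rsub_emb HK).
  - have := ty ('X - c%:P); rewrite polyXsubC_eq0 => /(_ isT).
    by rewrite rmorphB /= map_polyX map_polyC hornerXsubC.
  - by rewrite -(subrr c); apply: (placeD Hz) => //; apply: (placeN Hz).
have y0 : y != 0 by apply/eqP => y0; move: zy; rewrite y0 (place0 Hz).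
exists y^-1; split; [exact: (RsubV HK)|by rewrite invr_eq0|].
exact: ((placeV_None Hz y0).1 zy).
Qed.

Lemma Mplaces_restr (R : realType) (F : fieldType) (K : set F) (z : F -> option R) :
  Rplace (@id F) z -> Mplaces (@proj1_sig F K) (fun u => z (proj1_sig u)).
Proof.
move=> [H1 [HD [HM HV]]]; split; first by move=> u; apply: H1.
split; first by move=> u v w a b; apply: HD.
split; first by move=> u v w a b; apply: HM.
by move=> u v; apply: HV.
Qed.

Theorem theorem8p2 (R : realType) (F : fieldType) (emb : {rmorphism R -> F})
  (F1 F2 : set F) :
  is_Rsubfield emb F1 -> is_Rsubfield emb F2 ->
  function_field emb F1 -> function_field emb F2 ->
  trdeg_ge1 emb F1 -> trdeg_ge1 emb F2 ->
  lin_disjoint emb F1 F2 ->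
  gen_field emb (F1 `|` F2) = setT ->
  forall iota : ({x : F | F1 x} -> option R) * ({x : F | F2 x} -> option R) ->
                (F -> option R),
  compatible_embedding iota ->
  M_dense (iota @` (Mplaces (@proj1_sig F F1) `*` Mplaces (@proj1_sig F F2))) /\
  (forall bs : seq F, basic_open (R:=R) bs !=set0 ->
     infinite_set (basic_open (R:=R) bs `\`
       iota @` (Mplaces (@proj1_sig F F1) `*` Mplaces (@proj1_sig F F2)))).
Proof.
move=> HF1 HF2 [s1 F1E] [s2 F2E] tr1 tr2 ld F12 iota [iotaM [_ iotaE]].
have fg x : exists rs, Qgen emb (s1 ++ s2) rs x.
  apply: (@gen_field_Qgen R F emb (s1 ++ s2) x _) => K HK sK.
  have : gen_field emb (F1 `|` F2) x by rewrite F12.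
  apply=> // y [|]; rewrite ?F1E ?F2E; apply=> // t ts; apply: sK.
    by rewrite /= mem_cat ts.
  by rewrite /= mem_cat ts orbT.
have [x [F1x tx]] := tr1.
pose restr (z : F -> option R) : ({x : F | F1 x} -> option R) * ({x : F | F2 x} -> option R) :=
  (fun u => z (proj1_sig u), fun u => z (proj1_sig u)).
pose M12 := @Mplaces R F _ (@proj1_sig F F1) `*` @Mplaces R F _ (@proj1_sig F F2).
have restrM z : Rplace (@id F) z -> M12 (restr z).
  by move=> Hz; split; exact: Mplaces_restr.
have iota_restr z : Rplace (@id F) z -> same_restr F1 F2 z (iota (restr z)).
  move=> /restrM/iotaE[/= E1 E2]; split=> [a Fa|b Fb].
    by have := congr1 (fun f => f (exist _ a Fa)) E1.
  by have := congr1 (fun f => f (exist _ b Fb)) E2.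
split.
  move=> U [UM Uopen] [z0 Uz0]; have [bs [bsz0 bsU]] := Uopen z0 Uz0.
  have [|z [Hz zemb _ zbs]] := @basic_open_contains_fibre _ _ _ _ _ HF1 HF2 F12 _ fg x tx bs [::].
    by exists z0.
  exists (iota (restr z)); split; last by exists (restr z) => //; exact: restrM.
  by apply/bsU/zbs; [exact/iotaM/restrM|exact: iota_restr].
move=> bs bs0 fin.
(* Counting infinity as 0 only adds a number to the finite set of values to be avoided. *)
pose f (z : F -> option R) := odflt 0 (z x).
have /finite_seqP[vals valsE] := finite_image f fin.
have [z [Hz zemb [a za aN] zbs]] := basic_open_contains_fibre HF1 HF2 F12 fg tx vals bs0.
(* Such a place lies in the open set with a value at [x] outside [vals], so it is not among the
   finitely many exceptions. *)
have bad z' : Rplace (@id F) z' -> same_restr F1 F2 z z' -> (iota @` M12) z'.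
  move=> Hz' zz'; apply: contrapT => nim; move/negP: aN; apply.
  have : [set` vals] a; last by [].
  rewrite -valsE; exists z'; last by rewrite /f zz'.1 // za.
  by split=> //; exact: zbs.
have [z1 [Hz1 z11 z12 z1inf]] := fibre_place HF1 HF2 F12 Hz zemb ld.
have [z2 [Hz2 z22 z21 z2inf]] : exists z' : F -> option R,
  [/\ Rplace (@id F) z', forall a, F2 a -> z' a = z a, forall b, F1 b -> z' b = z b &
      forall x y, F2 x -> x != 0 -> F1 y -> z y = Some 0 -> z' (y / x) = Some 0].
  apply: fibre_place Hz zemb _ => //; first by rewrite setUC.
  exact: lin_disjoint_sym.
(* The restrictions of [iota p] are [p], so the image meets each fibre in a single place. *)
have unique z' : same_restr F1 F2 z z' -> (iota @` M12) z' -> z' = iota (restr z).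
  move=> zz' [p pM pE]; rewrite -pE in zz' *; case: zz' => e1 e2; congr iota; have [E1 E2] := iotaE p pM.
  rewrite [p]surjective_pairing; congr pair.
    by rewrite -E1; apply: funext => -[u Fu] /=; rewrite e1.
  by rewrite -E2; apply: funext => -[u Fu] /=; rewrite e2.
have S1 : same_restr F1 F2 z z1 by split.
have S2 : same_restr F1 F2 z z2 by split.
have z12E : z1 = z2 := etrans (unique _ S1 (bad _ Hz1 S1)) (esym (unique _ S2 (bad _ Hz2 S2))).
have [u [Fu u0 zu]] := infinitesimal_exists HF1 Hz zemb tr1.
have [v [Fv v0 zv]] := infinitesimal_exists HF2 Hz zemb tr2.
(* If the two places coincided, both [v / u] and [u / v] would have value 0, although their product
   is 1. *)
have zvu : z2 (v / u) = Some 0 by rewrite -z12E; exact: z1inf.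
have := placeM Hz2 (z2inf v u Fv v0 Fu zu) zvu.
have -> : u / v * (v / u) = 1 by field; rewrite u0 v0.
by rewrite (place1 Hz2) mul0r => -[/eqP]; rewrite oner_eq0.
Qed.
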